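(* Let $\alpha > 0$ and $\beta > 0$. For any $\epsilon > 0$ and any $y \in L^2(\mathbb{R}) \setminus \{0\}$, there exist a constant $B > 0$ and a Hilbert-Schmidt operator $H$ in $OPW([-\alpha,\alpha] \times [-\beta,\beta])$ such that $\| H \chi_{[-B,B]} - y \|_{L^2} < \epsilon$. Moreover, one can choose any $B > 0$ satisfying $\int_{\mathbb{R} \setminus [-B,B]} |y(x)|^2 \, dx < c \, \epsilon$ for some $0 < c < 1$; in particular, if $\operatorname{supp} y \subset [-M,M]$, then $B$ can be chosen to be $M$.
   Context: $\chi_{[-B,B]}$ is the characteristic function of $[-B,B]$. Every bounded linear operator $H : L^2(\mathbb{R}) \to L^2(\mathbb{R})$ corresponds uniquely to its spreading function (in general a tempered distribution) $\eta_H$ on $\mathbb{R}^2$, characterized by $$Hf(x) = \iint_{\mathbb{R}^2} \eta_H(t,\nu) \, e^{2\pi i x \nu} f(x-t) \, dt \, d\nu$$ (in the weak sense). If $H$ is Hilbert-Schmidt, then $\eta_H \in L^2(\mathbb{R}^2)$ and $\|H\|_{HS} = \|\eta_H\|_{L^2(\mathbb{R}^2)}$. For $S \subset \mathbb{R}^2$ the operator Paley-Wiener space is $OPW(S) = \{ H \in \mathcal{L}(L^2(\mathbb{R})) : \operatorname{supp} \eta_H \subset S \}$, where $\mathcal{L}(L^2(\mathbb{R}))$ denotes the bounded linear operators on $L^2(\mathbb{R})$. *)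

(* Defs.v *)
From HB Require Import structures.
From mathcomp Require Import all_boot all_order all_algebra.
From mathcomp Require Import all_classical all_reals all_analysis.
From mathcomp.real_closed Require Export complex.

Set Implicit Arguments.
Unset Strict Implicit.
Unset Printing Implicit Defensive.

Import Order.TTheory GRing.Theory Num.Theory.
Import numFieldNormedType.Exports.

Local Open Scope classical_set_scope.
Local Open Scope ring_scope.
Local Open Scope complex_scope.

Section ComplexFunctions.
Context {R : realType}.
Implicit Types f g : R -> R[i].

Local Notation mu := (@lebesgue_measure R).

Definition cabs (z : R[i]) : R := complex.Re `|z|.

Definition expi2pi (u : R) : R[i] := cos (2 * pi * u) +i* sin (2 * pi * u).

Definition cmeasurable f : Prop :=
  measurable_fun setT (fun x => complex.Re (f x)) /\
  measurable_fun setT (fun x => complex.Im (f x)).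

Definition cintegral f : R[i] :=
  (\int[mu]_x complex.Re (f x))%R +i* (\int[mu]_x complex.Im (f x))%R.

Definition cderivable f (x : R) : Prop :=
  derivable (fun u => complex.Re (f u)) x 1 /\
  derivable (fun u => complex.Im (f u)) x 1.

Definition cderive f (x : R) : R[i] :=
  derive1 (fun u => complex.Re (f u)) x +i* derive1 (fun u => complex.Im (f u)) x.

(* Elements of the complex Hilbert space L^2(R) are handled through
   representatives; equality in L^2(R) is equality almost everywhere. *)

Definition L2norm f : \bar R := ('N[mu]_2%:E[(fun x => (cabs (f x))%:E)])%E.

Definition L2 : set (R -> R[i]) :=
  [set f | cmeasurable f /\ (L2norm f < +oo)%E].

Definition ae_equal f g : Prop := \forall x \ae mu, f x = g x.

Definition inner f g : R[i] := cintegral (fun x => f x * conjc (g x)).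

(* Support of an a.e. class of functions: the complement of the largest open
   set on which the class vanishes. *)
Definition L2supp f : set R :=
  [set x | forall U : set R, open U -> U x ->
     ~ (\forall u \ae mu, U u -> f u = 0)].

Definition chi (A : set R) : R -> R[i] := fun x => (\1_A x)%:C.

End ComplexFunctions.

Section Operators.
Context {R : realType}.
Implicit Types H : (R -> R[i]) -> (R -> R[i]).

(* Linearity and boundedness make H compatible with a.e. equality, so these are
   exactly the bounded linear operators on L^2(R); the values of H outside of
   L^2(R) are irrelevant. *)
Definition bounded_linear : set ((R -> R[i]) -> (R -> R[i])) :=
  [set H | [/\ forall f, L2 f -> L2 (H f),
     forall (a : R[i]) f g, L2 f -> L2 g ->
       ae_equal (H (fun x => a * f x + g x)) (fun x => a * H f x + H g x) &
     exists C : R, forall f, L2 f -> (L2norm (H f) <= C%:E * L2norm f)%E]].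

Definition orthonormal_basis (e : nat -> R -> R[i]) : Prop :=
  [/\ forall n, L2 (e n),
      forall m n, inner (e m) (e n) = (m == n)%:R &
      forall f, L2 f ->
        L2norm (fun x => f x - \sum_(k < n) inner f (e k) * e k x)
          @[n --> \oo] --> (0 : \bar R)].

(* The sum is the squared Hilbert-Schmidt norm; it does not depend on the
   orthonormal basis. *)
Definition hilbert_schmidt : set ((R -> R[i]) -> (R -> R[i])) :=
  [set H | bounded_linear H /\
     forall e, orthonormal_basis e ->
       (\sum_(0 <= n <oo) L2norm (H (e n)) ^+ 2 < +oo)%E].

End Operators.

Section SpreadingFunctions.
Context {R : realType}.
Implicit Types (f g : R -> R[i]) (phi psi : R * R -> R[i]).

Definition schwartz1 : set (R -> R[i]) :=
  [set f | forall n : nat,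
     (forall x, cderivable (iter n cderive f) x) /\
     (forall a : nat, exists K : R, forall x,
        `|x| ^+ a * cabs (iter n cderive f x) <= K)].

(* [slice k phi p] is phi along the line through p that is parallel to the
   second axis when k is true, and to the first axis otherwise. *)
Definition slice (k : bool) phi (p : R * R) : R -> R[i] :=
  fun u => if k then phi (p.1, u) else phi (u, p.2).

Definition coord (k : bool) (p : R * R) : R := if k then p.2 else p.1.

Definition pderivable (k : bool) phi (p : R * R) : Prop :=
  cderivable (slice k phi p) (coord k p).

Definition pderive (k : bool) phi : R * R -> R[i] :=
  fun p => cderive (slice k phi p) (coord k p).

Definition pderives (w : seq bool) phi : R * R -> R[i] := foldr pderive phi w.

Definition weighted (a b : nat) (w : seq bool) phi (p : R * R) : R :=
  `|p.1| ^+ a * `|p.2| ^+ b * cabs (pderives w phi p).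

(* Existence and boundedness of all iterated partial derivatives imply their
   continuity, so that phi is indeed C^oo. *)
Definition schwartz2 : set (R * R -> R[i]) :=
  [set phi | (forall w k p, pderivable k (pderives w phi) p) /\
     (forall a b w, exists K : R, forall p, weighted a b w phi p <= K)].

(* The increasing sequence of these norms generates the topology of S(R^2). *)
Definition schwartz_norm (N : nat) phi : R :=
  sup [set r | exists a b w p,
         [/\ (a <= N)%N, (b <= N)%N, (size w <= N)%N & r = weighted a b w phi p]].

(* Only the values of T on S(R^2) are relevant. *)
Definition tempered_distribution (T : (R * R -> R[i]) -> R[i]) : Prop :=
  (forall (a : R[i]) phi psi, schwartz2 phi -> schwartz2 psi ->
     T (fun p => a * phi p + psi p) = a * T phi + T psi) /\
  (exists (C : R) (N : nat), forall phi, schwartz2 phi ->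
     cabs (T phi) <= C * schwartz_norm N phi).

Definition fsupp phi : set (R * R) := closure [set p | phi p != 0].

Definition dsupp (T : (R * R -> R[i]) -> R[i]) : set (R * R) :=
  [set p | forall U : set (R * R), open U -> U p ->
     exists phi, [/\ schwartz2 phi, compact (fsupp phi),
                     fsupp phi `<=` U & T phi != 0]].

(* Exchanging the integrals in the pairing of
     Hf(x) = iint eta(t, nu) e^(2 pi i x nu) f(x - t) dt dnu
   with g gives <Hf, g> = iint eta(t, nu) [tf_product f g (t, nu)] dt dnu,
   where [tf_product f g] is a Schwartz function when f and g are. *)
Definition tf_product f g : R * R -> R[i] :=
  fun p => cintegral (fun x => expi2pi (x * p.2) * f (x - p.1) * conjc (g x)).

Definition spreading_function (H : (R -> R[i]) -> (R -> R[i]))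
    (eta : (R * R -> R[i]) -> R[i]) : Prop :=
  tempered_distribution eta /\
  forall f g, schwartz1 f -> schwartz1 g ->
    inner (H f) g = eta (tf_product f g).

Definition OPW (S : set (R * R)) : set ((R -> R[i]) -> (R -> R[i])) :=
  [set H | bounded_linear H /\
     exists eta, spreading_function H eta /\ dsupp eta `<=` S].

End SpreadingFunctions.

(* Main.v *)
(** Take [H f = m * (box_d * f)], where [box_d] is the normalised indicator function
of [[-d, d]] and [m] is a square-integrable function whose Fourier transform [n] is a
combination of indicator functions of short intervals inside [[-beta, beta]].  The
spreading function of [H] is [box_d(t) n(nu)], and its kernel [m(x) box_d(x - s)] is
square-integrable.  For small [d] the function [box_d * chi] is close to
[chi = chi_[-B,B]], so it remains to approximate [y] in [L^2(-B, B)] by such an [m].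
Polynomials are dense there by Weierstrass' theorem, each polynomial is a uniform
limit of trigonometric polynomials of arbitrarily low frequencies because
[(e^(2 pi i delta x) - 1) / (2 pi i delta)] tends to [x], and multiplication by a slow
cardinal sine, which is close to [1] on [[-B, B]], makes such a trigonometric
polynomial square-integrable at the price of a small enlargement of its spectrum. *)

From HB Require Import structures.
Require Import Defs.
From mathcomp Require Import all_boot all_order all_algebra.
From mathcomp Require Import all_classical all_reals all_analysis.
From mathcomp Require Import measurable_realfun ring lra.
Set Implicit Arguments.
Unset Strict Implicit.
Unset Printing Implicit Defensive.
Import Order.TTheory GRing.Theory Num.Theory.
Import numFieldNormedType.Exports.
Local Open Scope classical_set_scope.
Local Open Scope ring_scope.

(** * Complex numbers and complex-valued integrals *)

(** Compact support of the spreading function in [nu] makes [m] band-limited, so [m] cannot be cut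
    off outside [[-B, B]], and its values there are unrelated to [y]. This is harmless because
    [box_d * chi] vanishes outside [[-B - d, B + d]]: besides the tail of [y] and the approximation
    error inside [[-B, B]], only two strips of width [2d] around the endpoints contribute, and they
    contribute at most a constant times [(sup |m|)^2 d]. Hence [m] is fixed first and [d]
    afterwards; the choices do not interfere, since the bound [beta] concerns [m] alone and the
    bound [alpha] concerns [d] alone. Errors are kept as squared norms, so that each triangle
    inequality costs a factor 2. The theorem compares the squared norm of the tail with [c * eps],
    whereas the argument needs a multiple of [eps^2]; this is why [c] depends on [eps]. The
    Hilbert-Schmidt bound comes from Bessel's inequality for the single function [box_d(x - .)] at
    each fixed [x], integrated against [|m(x)|^2]. *)

Section ComplexNumbers.
Context {R : realType}.
Implicit Types z w : R[i].
Local Notation Re := complex.Re.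
Local Notation Im := complex.Im.

Lemma ReM z w : Re (z * w) = Re z * Re w - Im z * Im w.
Proof. by case: z; case: w. Qed.

Lemma ImM z w : Im (z * w) = Re z * Im w + Im z * Re w.
Proof. by case: z; case: w. Qed.

Lemma ReD z w : Re (z + w) = Re z + Re w.
Proof. by case: z; case: w. Qed.

Lemma ImD z w : Im (z + w) = Im z + Im w.
Proof. by case: z; case: w. Qed.

Lemma ReN z : Re (- z) = - Re z.
Proof. by case: z. Qed.

Lemma ImN z : Im (- z) = - Im z.
Proof. by case: z. Qed.

Lemma ReJ z : Re (conjc z) = Re z.
Proof. by case: z. Qed.

Lemma ImJ z : Im (conjc z) = - Im z.
Proof. by case: z. Qed.

Lemma complex_ext z w : Re z = Re w -> Im z = Im w -> z = w.
Proof. by case: z; case: w => a b c d /= -> ->. Qed.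

Lemma cabs_ge0 z : 0 <= cabs z.
Proof. by rewrite /cabs normc_def sqrtr_ge0. Qed.

Lemma cabs2 z : cabs z ^+ 2 = Re z ^+ 2 + Im z ^+ 2.
Proof. by rewrite /cabs normc_def /= sqr_sqrtr ?addr_ge0 ?sqr_ge0. Qed.

Lemma cabsM z w : cabs (z * w) = cabs z * cabs w.
Proof. by rewrite /cabs normrM ReM [Im `|z|]ger0_Im// mul0r subr0. Qed.

Lemma cabsD z w : cabs (z + w) <= cabs z + cabs w.
Proof. exact: le_normcD. Qed.

Lemma cabsN z : cabs (- z) = cabs z.
Proof. exact: normcN. Qed.

Lemma cabsJ z : cabs (conjc z) = cabs z.
Proof. by rewrite /cabs normcJ. Qed.

Lemma cabs0 : cabs 0 = 0 :> R.
Proof. by rewrite /cabs normr0. Qed.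

Lemma cabsR (x : R) : cabs (x%:C)%C = `|x|.
Proof. by rewrite /cabs normc_def /= expr0n /= addr0 sqrtr_sqr. Qed.

Lemma cabs_Re z : `|Re z| <= cabs z.
Proof.
by rewrite -ler_sqr ?nnegrE ?cabs_ge0// cabs2 real_normK ?num_real// lerDl sqr_ge0.
Qed.

Lemma cabs_Im z : `|Im z| <= cabs z.
Proof.
by rewrite -ler_sqr ?nnegrE ?cabs_ge0// cabs2 real_normK ?num_real// lerDr sqr_ge0.
Qed.

Lemma cabs_le z : cabs z <= `|Re z| + `|Im z|.
Proof.
rewrite -ler_sqr ?nnegrE ?cabs_ge0 ?addr_ge0// cabs2 sqrrD !real_normK ?num_real//.
by rewrite addrAC lerDl mulrn_wge0// mulr_ge0.
Qed.

Lemma cabs_sum (I : Type) (r : seq I) (P : pred I) (F : I -> R[i]) :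
  cabs (\sum_(i <- r | P i) F i) <= \sum_(i <- r | P i) cabs (F i).
Proof.
elim/big_rec2: _ => [|i x y _ h]; first by rewrite cabs0.
by apply: le_trans (cabsD _ _) _; rewrite lerD2l.
Qed.

(** Integrated, this replaces Minkowski's inequality, so that square roots of integrals are
    avoided. *)
Lemma cabs2D z w : cabs (z + w) ^+ 2 <= 2 * (cabs z ^+ 2 + cabs w ^+ 2).
Proof.
rewrite !cabs2 ReD ImD; have := sqr_ge0 (Re z - Re w).
by have := sqr_ge0 (Im z - Im w); nra.
Qed.

Lemma conjcMK z : z * conjc z = ((cabs z ^+ 2)%:C)%C.
Proof. by rewrite cabs2; case: z => a b; simpc; congr Complex => /=; ring. Qed.

Lemma cabs_expi2pi (u : R) : cabs (expi2pi u) = 1.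
Proof.
apply/eqP; rewrite -(@eqrXn2 _ 2) ?cabs_ge0// cabs2 /= expr1n.
by rewrite cos2Dsin2.
Qed.

Lemma expi2piD (u v : R) : expi2pi (u + v) = expi2pi u * expi2pi v.
Proof.
apply: complex_ext; rewrite ?ReM ?ImM /= mulrDr ?cosD ?sinD//.
by rewrite addrC [_ * sin _]mulrC.
Qed.

Lemma expi2pi0 : expi2pi (0 : R) = 1.
Proof. by rewrite /expi2pi mulr0 cos0 sin0. Qed.

Lemma expi2piX (u : R) n : expi2pi u ^+ n = expi2pi (n%:R * u).
Proof.
elim: n => [|n IH]; first by rewrite mul0r expi2pi0 expr0.
by rewrite exprS IH -expi2piD -natr1 mulrDl mul1r addrC.
Qed.

End ComplexNumbers.

Section ComplexMeasurable.
Context d {T : measurableType d} {R : realType}.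
Local Notation Re := complex.Re.
Local Notation Im := complex.Im.

(** For [T = R] this is [cmeasurable]; the general domain serves functions on the plane, to which
    Fubini's theorem is applied. *)
Definition cmfun (f : T -> R[i]) : Prop :=
  measurable_fun setT (fun x => Re (f x)) /\
  measurable_fun setT (fun x => Im (f x)).
Implicit Types f g : T -> R[i].

Lemma cmfunD f g : cmfun f -> cmfun g -> cmfun (fun x => f x + g x).
Proof.
move=> [f1 f2] [g1 g2]; split.
  by under eq_fun do rewrite ReD; exact: measurable_funD.
by under eq_fun do rewrite ImD; exact: measurable_funD.
Qed.

Lemma cmfunN f : cmfun f -> cmfun (fun x => - f x).
Proof.
move=> [f1 f2]; split.
  by under eq_fun do rewrite ReN; exact: measurableT_comp.
by under eq_fun do rewrite ImN; exact: measurableT_comp.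
Qed.

Lemma cmfunB f g : cmfun f -> cmfun g -> cmfun (fun x => f x - g x).
Proof. by move=> mf mg; apply: cmfunD => //; exact: cmfunN. Qed.

Lemma cmfunM f g : cmfun f -> cmfun g -> cmfun (fun x => f x * g x).
Proof.
move=> [f1 f2] [g1 g2]; split.
  under eq_fun do rewrite ReM.
  by apply: measurable_funB; exact: measurable_funM.
under eq_fun do rewrite ImM.
by apply: measurable_funD; exact: measurable_funM.
Qed.

Lemma cmfunJ f : cmfun f -> cmfun (fun x => conjc (f x)).
Proof.
move=> [f1 f2]; split; first by under eq_fun do rewrite ReJ.
by under eq_fun do rewrite ImJ; exact: measurableT_comp.
Qed.

Lemma cmfun_cst z : cmfun (fun=> z).
Proof. by split; exact: measurable_cst. Qed.

Lemma cmfunR (h : T -> R) : measurable_fun setT h -> cmfun (fun x => (h x)%:C)%C.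
Proof. by move=> mh; split => //=; exact: measurable_cst. Qed.

Lemma cmfun_sum n (F : 'I_n -> T -> R[i]) : (forall i, cmfun (F i)) ->
  cmfun (fun x => \sum_(i < n) F i x).
Proof.
elim: n F => [|n IH] F mF.
  by under eq_fun do rewrite big_ord0; exact: cmfun_cst.
under eq_fun do rewrite big_ord_recr/=.
by apply: cmfunD => //; exact: IH.
Qed.

Lemma measurable_cabs f : cmfun f -> measurable_fun setT (fun x => cabs (f x)).
Proof.
move=> [f1 f2].
rewrite (_ : (fun x => _) = @Num.sqrt R \o (fun x => Re (f x) ^+ 2 + Im (f x) ^+ 2)).
  apply: (measurableT_comp (@continuous_measurable_fun R _ (@sqrt_continuous R))).
  by apply: measurable_funD; exact: measurable_funX.
by apply/funext => x; rewrite /= -cabs2 sqrtr_sqr ger0_norm ?cabs_ge0.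
Qed.

Lemma measurable_cabs2 f : cmfun f ->
  measurable_fun setT (fun x => (cabs (f x) ^+ 2)%:E).
Proof.
by move=> mf; apply/measurable_EFinP/measurable_funX; exact: measurable_cabs.
Qed.

End ComplexMeasurable.

Lemma cmfun_comp d d' (T : measurableType d) (T' : measurableType d')
  (R : realType) (f : T -> R[i]) (h : T' -> T) :
  cmfun f -> measurable_fun setT h -> cmfun (fun x => f (h x)).
Proof.
by move=> [f1 f2] mh; split; [exact: (measurableT_comp f1 mh)|exact: (measurableT_comp f2 mh)].
Qed.

Section ComplexIntegral.
Context {R : realType}.
Local Notation Re := complex.Re.
Local Notation Im := complex.Im.
Local Notation mu := (@lebesgue_measure R).
Implicit Types f g : R -> R[i].

Definition cintegrable f : Prop :=
  mu.-integrable setT (EFin \o (fun x => Re (f x))) /\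
  mu.-integrable setT (EFin \o (fun x => Im (f x))).

Lemma cintegrable_cmfun f : cintegrable f -> cmfun f.
Proof.
by move=> [/measurable_int/measurable_EFinP ? /measurable_int/measurable_EFinP ?].
Qed.

Lemma cintegrable_le f (g : R -> R) : cmfun f ->
  mu.-integrable setT (EFin \o g) -> (forall x, cabs (f x) <= g x) -> cintegrable f.
Proof.
move=> [f1 f2] ig fg; split; apply: (le_integrable _ _ _ ig) => //.
- exact/measurable_EFinP.
- move=> x _ /=; rewrite lee_fin; apply: le_trans (cabs_Re _) _.
  exact: le_trans (fg x) (ler_norm _).
- exact/measurable_EFinP.
- move=> x _ /=; rewrite lee_fin; apply: le_trans (cabs_Im _) _.
  exact: le_trans (fg x) (ler_norm _).
Qed.

Lemma integrable_cabs f : cintegrable f ->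
  mu.-integrable setT (EFin \o (fun x => cabs (f x))).
Proof.
move=> cf; have [f1 f2] := cf.
have ig : mu.-integrable setT (EFin \o (fun x => `|Re (f x)| + `|Im (f x)|)).
  exact: (integrableD measurableT (integrable_norm f1) (integrable_norm f2)).
apply: (le_integrable _ _ _ ig) => //.
  exact/measurable_EFinP/measurable_cabs/cintegrable_cmfun.
move=> x _ /=; rewrite lee_fin ger0_norm ?cabs_ge0//.
exact: le_trans (cabs_le _) (ler_norm _).
Qed.

Lemma cintegrableD f g : cintegrable f -> cintegrable g ->
  cintegrable (fun x => f x + g x).
Proof.
move=> [f1 f2] [g1 g2]; split.
  under eq_fun do rewrite ReD.
  exact: (integrableD measurableT f1 g1).
under eq_fun do rewrite ImD.
exact: (integrableD measurableT f2 g2).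
Qed.

Lemma cintegrableZ (a : R[i]) f : cintegrable f -> cintegrable (fun x => a * f x).
Proof.
move=> cf; apply: (@cintegrable_le _ (fun x => cabs a * cabs (f x))).
- by apply: cmfunM; [exact: cmfun_cst|exact: cintegrable_cmfun].
- exact: (integrableZl measurableT (cabs a) (integrable_cabs cf)).
- by move=> x; rewrite cabsM.
Qed.

Lemma cintegrableJ f : cintegrable f -> cintegrable (fun x => conjc (f x)).
Proof.
move=> cf; apply: (cintegrable_le _ (integrable_cabs cf)).
  exact/cmfunJ/cintegrable_cmfun.
by move=> x; rewrite cabsJ.
Qed.

Lemma cintegrableM_bounded f g (K : R) : cintegrable f -> cmfun g ->
  (forall x, cabs (g x) <= K) -> cintegrable (fun x => g x * f x).
Proof.
move=> cf mg gK; apply: (@cintegrable_le _ (fun x => K * cabs (f x))).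
- by apply: cmfunM => //; exact: cintegrable_cmfun.
- exact: (integrableZl measurableT K (integrable_cabs cf)).
- by move=> x; rewrite cabsM ler_wpM2r ?cabs_ge0.
Qed.

Lemma cintegrable0 : cintegrable (fun=> 0).
Proof. by split; exact: integrable0. Qed.

Lemma cintegrable_sum n (F : 'I_n -> R -> R[i]) : (forall i, cintegrable (F i)) ->
  cintegrable (fun x => \sum_(i < n) F i x).
Proof.
elim: n F => [|n IH] F mF.
  by under eq_fun do rewrite big_ord0; exact: cintegrable0.
under eq_fun do rewrite big_ord_recr/=.
by apply: cintegrableD => //; exact: IH.
Qed.

Lemma eq_cintegral f g : f =1 g -> cintegral f = cintegral g.
Proof. by move=> fg; congr cintegral; exact/funext. Qed.

Lemma cintegralD f g : cintegrable f -> cintegrable g ->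
  cintegral (fun x => f x + g x) = cintegral f + cintegral g.
Proof.
move=> [f1 f2] [g1 g2]; apply: complex_ext; rewrite ?ReD ?ImD /=.
  by under eq_Rintegral do rewrite ReD; exact: RintegralD.
by under eq_Rintegral do rewrite ImD; exact: RintegralD.
Qed.

Lemma cintegralZ (a : R[i]) f : cintegrable f ->
  cintegral (fun x => a * f x) = a * cintegral f.
Proof.
move=> [f1 f2].
have Z r (h : R -> R) : mu.-integrable setT (EFin \o h) ->
    mu.-integrable setT (EFin \o (fun x => r * h x)).
  by move=> ih; exact: (integrableZl measurableT r ih).
apply: complex_ext; rewrite ?ReM ?ImM /=.
  under eq_Rintegral do rewrite ReM.
  by rewrite RintegralB ?RintegralZl//; exact: Z.
under eq_Rintegral do rewrite ImM.
by rewrite RintegralD ?RintegralZl//; exact: Z.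
Qed.

Lemma cintegralJ f : cintegrable f ->
  cintegral (fun x => conjc (f x)) = conjc (cintegral f).
Proof.
move=> [f1 f2]; apply: complex_ext; rewrite ?ReJ ?ImJ /=.
  by under eq_Rintegral do rewrite ReJ.
under eq_Rintegral do rewrite ImJ -mulN1r.
by rewrite RintegralZl// mulN1r.
Qed.

Lemma cintegral0 : cintegral (fun=> 0) = 0 :> R[i].
Proof. by apply: complex_ext => /=; rewrite /Rintegral integral0. Qed.

Lemma cintegral_sum n (F : 'I_n -> R -> R[i]) : (forall i, cintegrable (F i)) ->
  cintegral (fun x => \sum_(i < n) F i x) = \sum_(i < n) cintegral (F i).
Proof.
elim: n F => [|n IH] F mF.
  rewrite big_ord0; under eq_cintegral do rewrite big_ord0.
  exact: cintegral0.
rewrite big_ord_recr/= -IH// -cintegralD//; last exact: cintegrable_sum.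
by apply: eq_cintegral => x; rewrite big_ord_recr.
Qed.

(** The factor 2 comes from bounding the real and imaginary parts separately. It is the source of
    the 2 in the later bounds on [sinc], [avg] and [box_inner]. *)
Lemma cabs_cintegral_le f (g : R -> R) : cmfun f ->
  mu.-integrable setT (EFin \o g) -> (forall x, cabs (f x) <= g x) ->
  cabs (cintegral f) <= 2 * \int[mu]_x g x.
Proof.
move=> mf ig fg; have [f1 f2] := cintegrable_le mf ig fg.
apply: le_trans (cabs_le _) _; rewrite mulrDl mul1r lerD//=.
  apply: (le_trans (le_normr_Rintegral measurableT f1)).
  apply: le_Rintegral => //; first exact: integrable_norm f1.
  by move=> x _; exact: le_trans (cabs_Re _) (fg x).
apply: (le_trans (le_normr_Rintegral measurableT f2)).
apply: le_Rintegral => //; first exact: integrable_norm f2.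
by move=> x _; exact: le_trans (cabs_Im _) (fg x).
Qed.

Lemma measurable_integral_slice (F : R * R -> \bar R) : measurable_fun setT F ->
  (forall p, 0 <= F p)%E -> measurable_fun setT (fun x => \int[mu]_y F (x, y))%E.
Proof.
move=> mF F0.
exact: (@measurable_fun_fubini_tonelli_F _ _ _ _ R mu F mF F0).
Qed.

(** Every slice is taken integrable, not just almost every one: the inner real integral is a [fine],
    and finiteness at each point lets [fineK] undo it. *)
Lemma Rintegral_Fubini (F : R * R -> R) : measurable_fun setT F ->
  (\int[mu]_x \int[mu]_y (`|F (x, y)|)%:E < +oo)%E ->
  (forall x, mu.-integrable setT (EFin \o (fun y => F (x, y)))) ->
  (forall y, mu.-integrable setT (EFin \o (fun x => F (x, y)))) ->
  \int[mu]_x \int[mu]_y F (x, y) = \int[mu]_y \int[mu]_x F (x, y).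
Proof.
move=> mF Foo i1 i2.
have iF : (mu \x mu)%E.-integrable setT (EFin \o F).
  by apply/integrable12ltyP => //; exact/measurable_EFinP.
have := Fubini iF; rewrite /Rintegral /= => FF.
have -> : (\int[mu]_x (fine (\int[mu]_y (F (x, y))%:E))%:E = \int[mu]_x \int[mu]_y (F (x, y))%:E)%E.
  by apply: eq_integral => x _; rewrite fineK//; exact: integrable_fin_num (i1 x).
rewrite FF; congr fine; apply: eq_integral => y _.
by rewrite fineK//; exact: integrable_fin_num (i2 y).
Qed.

Lemma cintegral_Fubini (F : R * R -> R[i]) : cmfun F ->
  (\int[mu]_x \int[mu]_y (cabs (F (x, y)))%:E < +oo)%E ->
  (forall x, cintegrable (fun y => F (x, y))) ->
  (forall y, cintegrable (fun x => F (x, y))) ->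
  cintegral (fun x => cintegral (fun y => F (x, y))) =
  cintegral (fun y => cintegral (fun x => F (x, y))).
Proof.
move=> mF Foo i1 i2; have mF1 x : cmfun (fun y => F (x, y)) by exact: cintegrable_cmfun.
have mFx : measurable_fun setT (EFin \o (fun p => cabs (F p))).
  exact/measurable_EFinP/measurable_cabs.
have H (G : R * R -> R) : measurable_fun setT G -> (forall p, `|G p| <= cabs (F p)) ->
    (\int[mu]_x \int[mu]_y (`|G (x, y)|)%:E < +oo)%E.
  move=> mG GF; apply: le_lt_trans Foo.
  have mG' : measurable_fun setT (EFin \o (fun p => `|G p|)).
    by apply/measurable_EFinP; exact: measurableT_comp.
  apply: ge0_le_integral => //.
  - by move=> x _; exact: integral_ge0.
  - by apply: (measurable_integral_slice mG') => p; rewrite lee_fin.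
  - by apply: (measurable_integral_slice mFx) => p; rewrite lee_fin cabs_ge0.
  - move=> x _; apply: ge0_le_integral => //.
    + exact: (measurableT_comp mG' (pair1_measurable x)).
    + exact: (measurableT_comp mFx (pair1_measurable x)).
    + by move=> y _; rewrite lee_fin.
have [F1 F2] := mF.
apply: complex_ext => /=.
  apply: (@Rintegral_Fubini (fun p => Re (F p))) => //.
  - exact: (H _ F1 (fun p => cabs_Re (F p))).
  - by move=> x; case: (i1 x).
  - by move=> y; case: (i2 y).
apply: (@Rintegral_Fubini (fun p => Im (F p))) => //.
- exact: (H _ F2 (fun p => cabs_Im (F p))).
- by move=> x; case: (i1 x).
- by move=> y; case: (i2 y).
Qed.

End ComplexIntegral.

(** * Square-integrable functions and Bessel's inequality *)

Section SquareIntegrable.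
Context {R : realType}.
Local Notation Re := complex.Re.
Local Notation Im := complex.Im.
Local Notation mu := (@lebesgue_measure R).
Implicit Types f g h : R -> R[i].

Definition sq f : \bar R := (\int[mu]_x (cabs (f x) ^+ 2)%:E)%E.

(** The real-valued companion of [sq], used for algebra. It defaults to 0 when [sq f] is infinite,
    and agrees with [sq f] on [L2]. *)
Definition nrm2 f : R := \int[mu]_x (cabs (f x) ^+ 2).

Lemma sq_ge0 f : (0 <= sq f)%E.
Proof. by apply: integral_ge0 => x _; rewrite lee_fin sqr_ge0. Qed.

Lemma nrm2_ge0 f : 0 <= nrm2 f.
Proof. by apply: Rintegral_ge0 => x _; exact: sqr_ge0. Qed.

Lemma le_sq f g : cmfun f -> cmfun g -> (forall x, cabs (f x) <= cabs (g x)) ->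
  (sq f <= sq g)%E.
Proof.
move=> mf mg fg; apply: ge0_le_integral => //.
- by move=> x _; rewrite lee_fin sqr_ge0.
- exact: measurable_cabs2.
- exact: measurable_cabs2.
- by move=> x _; rewrite lee_fin ler_sqr ?nnegrE ?cabs_ge0.
Qed.

Lemma L2normE f : L2norm f = poweR (sq f) 2^-1.
Proof.
rewrite /L2norm unlock; congr poweR; apply: eq_integral => x _ /=.
by rewrite ger0_norm ?cabs_ge0// -powR_mulrn ?cabs_ge0.
Qed.

Lemma L2norm_sq f : (L2norm f ^+ 2 = sq f)%E.
Proof.
rewrite L2normE; have := sq_ge0 f; case: (sq f) => [r|_|//].
  rewrite lee_fin => r0; rewrite poweR_EFin -EFin_expe; congr EFin.
  by rewrite powR12_sqrt// sqr_sqrtr.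
by rewrite poweRyr ?invr_eq0// expe2 mulyy.
Qed.

Lemma L2norm_lt f (e : R) : 0 < e -> (sq f < (e ^+ 2)%:E)%E -> (L2norm f < e%:E)%E.
Proof.
move=> e0; rewrite L2normE; have := sq_ge0 f; case: (sq f) => [r|//|//].
rewrite !lee_fin lte_fin => r0 re; rewrite poweR_EFin lte_fin powR12_sqrt//.
by rewrite -[ltRHS](@ger0_norm _ e) ?ltW// -sqrtr_sqr ltr_sqrt// exprn_gt0.
Qed.

Lemma L2norm_leM f g (C : R) : 0 <= C -> (sq g < +oo)%E ->
  (sq f <= (C ^+ 2)%:E * sq g)%E -> (L2norm f <= C%:E * L2norm g)%E.
Proof.
move=> C0 + fg; rewrite !L2normE.
have -> : C%:E = poweR (C ^+ 2)%:E 2^-1.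
  by rewrite poweR_EFin powR12_sqrt ?sqr_ge0// sqrtr_sqr ger0_norm.
rewrite -poweRM ?sq_ge0 ?lee_fin ?sqr_ge0//.
move: fg; have := sq_ge0 g; have := sq_ge0 f.
case: (sq g) => [b|//|//]; case: (sq f) => [a|_|//].
- rewrite -EFinM !poweR_EFin !lee_fin => a0 b0 ab _.
  by apply: ge0_ler_powR; rewrite ?nnegrE ?invr_ge0// mulr_ge0 ?sqr_ge0.
- by move=> _; rewrite -EFinM leNgt ltry.
Qed.

Lemma L2P f : L2 f <-> cmfun f /\ (sq f < +oo)%E.
Proof.
split=> [[mf]|[mf foo]].
  rewrite L2normE => h; split=> //; rewrite ltey; apply: contraTN h => /eqP ->.
  by rewrite poweRyr// invr_eq0.
by split=> //; rewrite L2normE poweR_lty.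
Qed.

Lemma L2_cmfun f : L2 f -> cmfun f.
Proof. by case. Qed.

Lemma sqE f : L2 f -> sq f = (nrm2 f)%:E.
Proof.
move=> /L2P[mf foo]; rewrite /nrm2 /Rintegral fineK//.
by rewrite ge0_fin_numE//; exact: sq_ge0.
Qed.

Lemma L2_integrable f : L2 f -> mu.-integrable setT (EFin \o (fun x => cabs (f x) ^+ 2)).
Proof.
move=> /L2P[mf foo]; apply/integrableP; split; first exact: measurable_cabs2.
by under eq_integral do rewrite /= ger0_norm ?sqr_ge0//.
Qed.

Lemma L2_le f g : cmfun f -> L2 g -> (forall x, cabs (f x) <= cabs (g x)) -> L2 f.
Proof.
move=> mf /L2P[mg goo] fg; apply/L2P; split => //.
exact: le_lt_trans (le_sq mf mg fg) goo.
Qed.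

Lemma L2J f : L2 f -> L2 (fun x => conjc (f x)).
Proof.
move=> Lf; apply: (L2_le _ Lf) => [|x]; last by rewrite cabsJ.
exact/cmfunJ/L2_cmfun.
Qed.

Lemma sqD f g : cmfun f -> cmfun g ->
  (sq (fun x => f x + g x)%R <= 2%:E * (sq f + sq g))%E.
Proof.
move=> mf mg; rewrite /sq -ge0_integralD//; try exact: measurable_cabs2.
- rewrite -ge0_integralZl//.
  + apply: ge0_le_integral => //.
    * by move=> x _; rewrite lee_fin sqr_ge0.
    * exact/measurable_cabs2/cmfunD.
    * apply: measurable_funeM; apply: emeasurable_funD; exact: measurable_cabs2.
    * by move=> x _; rewrite -EFinD -EFinM lee_fin cabs2D.
  + by apply: emeasurable_funD; exact: measurable_cabs2.
  + by move=> x _; rewrite adde_ge0// lee_fin sqr_ge0.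
- by move=> x _; rewrite lee_fin sqr_ge0.
- by move=> x _; rewrite lee_fin sqr_ge0.
Qed.

Lemma sqZ (a : R[i]) f : cmfun f ->
  (sq (fun x => a * f x)%R = (cabs a ^+ 2)%:E * sq f)%E.
Proof.
move=> mf; rewrite /sq -ge0_integralZl//.
- by apply: eq_integral => x _; rewrite cabsM exprMn EFinM.
- exact: measurable_cabs2.
- by move=> x _; rewrite lee_fin sqr_ge0.
- by rewrite lee_fin sqr_ge0.
Qed.

Lemma L2D f g : L2 f -> L2 g -> L2 (fun x => f x + g x).
Proof.
move=> Lf Lg; apply/L2P; split; first by apply: cmfunD; exact: L2_cmfun.
apply: le_lt_trans (sqD (L2_cmfun Lf) (L2_cmfun Lg)) _.
by rewrite !sqE// -EFinD -EFinM ltry.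
Qed.

Lemma L2Z (a : R[i]) f : L2 f -> L2 (fun x => a * f x).
Proof.
move=> Lf; apply/L2P; split.
  by apply: cmfunM; [exact: cmfun_cst|exact: L2_cmfun].
by rewrite sqZ ?sqE// ?ltry//; exact: L2_cmfun.
Qed.

Lemma L2M_cintegrable f g : L2 f -> L2 g -> cintegrable (fun x => f x * g x).
Proof.
move=> Lf Lg; apply: (@cintegrable_le _ _ (fun x => cabs (f x) ^+ 2 + cabs (g x) ^+ 2)).
- by apply: cmfunM; exact: L2_cmfun.
- exact: (integrableD measurableT (L2_integrable Lf) (L2_integrable Lg)).
- move=> x; rewrite cabsM; have := cabs_ge0 (f x); have := cabs_ge0 (g x).
  by have := sqr_ge0 (cabs (f x) - cabs (g x)); nra.
Qed.

Lemma inner_cintegrable f g : L2 f -> L2 g -> cintegrable (fun x => f x * conjc (g x)).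
Proof. by move=> Lf Lg; apply: L2M_cintegrable => //; exact: L2J. Qed.

Lemma innerDl f1 f2 g : L2 f1 -> L2 f2 -> L2 g ->
  inner (fun x => f1 x + f2 x) g = inner f1 g + inner f2 g.
Proof.
move=> L1 L2' Lg; rewrite /inner -cintegralD; try exact: inner_cintegrable.
by apply: eq_cintegral => x; rewrite mulrDl.
Qed.

Lemma innerZl (a : R[i]) f g : L2 f -> L2 g ->
  inner (fun x => a * f x) g = a * inner f g.
Proof.
move=> Lf Lg; rewrite /inner -cintegralZ; last exact: inner_cintegrable.
by apply: eq_cintegral => x; rewrite mulrA.
Qed.

Lemma inner_self f : inner f f = ((nrm2 f)%:C)%C.
Proof.
rewrite /inner /cintegral; apply: complex_ext => /=.
  by apply: eq_Rintegral => x _; rewrite conjcMK.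
by under eq_Rintegral do rewrite conjcMK /=; rewrite /Rintegral integral0.
Qed.

Lemma cabs2_subM (c z w : R[i]) : cabs (z - c * w) ^+ 2 =
  cabs z ^+ 2 + (-2) * Re (conjc c * (z * conjc w)) + cabs c ^+ 2 * cabs w ^+ 2.
Proof.
rewrite !cabs2; case: c z w => [c1 c2] [z1 z2] [w1 w2] /=; ring.
Qed.

Lemma nrm2_subZ (c : R[i]) f g : L2 f -> L2 g ->
  nrm2 (fun x => f x - c * g x) =
  nrm2 f - 2 * Re (conjc c * inner f g) + cabs c ^+ 2 * nrm2 g.
Proof.
move=> Lf Lg; have ifg := inner_cintegrable Lf Lg.
have [ir _] := cintegrableZ (conjc c) ifg.
have if1 := L2_integrable Lf; have ig1 := L2_integrable Lg.
have -> : nrm2 (fun x => f x - c * g x) =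
    \int[mu]_x ((cabs (f x) ^+ 2 + (-2) * Re (conjc c * (f x * conjc (g x)))) +
       cabs c ^+ 2 * cabs (g x) ^+ 2).
  by apply: eq_Rintegral => x _; rewrite cabs2_subM.
have ir2 : mu.-integrable setT (EFin \o (fun x => (-2) * Re (conjc c * (f x * conjc (g x))))).
  exact: (integrableZl measurableT (-2) ir).
rewrite RintegralD//; last 2 first.
- exact: (integrableD measurableT if1 ir2).
- exact: (integrableZl measurableT (cabs c ^+ 2) ig1).
rewrite RintegralD// !RintegralZl// -[in RHS](cintegralZ _ ifg)/=.
by rewrite mulNr.
Qed.

Lemma nrm2_sub_proj f g : L2 f -> L2 g -> nrm2 g = 1 ->
  nrm2 (fun x => f x - inner f g * g x) = nrm2 f - cabs (inner f g) ^+ 2.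
Proof.
move=> Lf Lg g1; rewrite nrm2_subZ// g1 mulr1 [conjc _ * _]mulrC conjcMK /=.
by rewrite mulrDl mul1r opprD addrA subrK.
Qed.

(** Expanding the squared norm of [f - t <f, g> g] for real [t] gives a nonnegative real quadratic
    in [t], whatever the phase of [<f, g>]; its minimiser is [t = 1 / nrm2 g]. *)
Lemma cauchy_schwarz f g : L2 f -> L2 g ->
  cabs (inner f g) ^+ 2 <= nrm2 f * nrm2 g.
Proof.
move=> Lf Lg; set i := inner f g.
have key (t : R) : 0 <= nrm2 f - 2 * t * cabs i ^+ 2 + t ^+ 2 * cabs i ^+ 2 * nrm2 g.
  have := nrm2_ge0 (fun x => f x - ((t%:C)%C * i) * g x).
  rewrite nrm2_subZ// -/i cabsM exprMn cabsR real_normK ?num_real//.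
  rewrite (_ : Re _ = t * cabs i ^+ 2); first by rewrite mulrA.
  by rewrite cabs2; case: i => a b /=; simpc => /=; ring.
move: key; set I := cabs i ^+ 2 => key.
have [F0|F0] := eqVneq (nrm2 g) 0.
  have [->|I0] := eqVneq I 0; first by rewrite F0 mulr0.
  (* With [nrm2 g = 0] the quadratic degenerates to an affine function of [t], and this [t] gives it
     the value [-1]. *)
  have := key ((nrm2 f + 1) / (2 * I)).
  rewrite F0 mulr0 addr0 (_ : 2 * _ * _ = nrm2 f + 1); last by field.
  by rewrite opprD addrA subrr add0r lerNr oppr0 ler10.
have Fp : 0 < nrm2 g by rewrite lt_neqAle eq_sym F0 nrm2_ge0.
have := key (nrm2 g)^-1.
rewrite (_ : _ + _ = nrm2 f - I / nrm2 g); last by field.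
by rewrite subr_ge0 ler_pdivrMr.
Qed.

(** The projections are removed one at a time. Each removal lowers the squared norm by one term of
    the sum, and what is left at the end has nonnegative squared norm. *)
Lemma bessel (e : nat -> R -> R[i]) h n :
  (forall k, L2 (e k)) -> (forall j k, inner (e j) (e k) = (j == k)%:R) -> L2 h ->
  \sum_(k < n) cabs (inner h (e k)) ^+ 2 <= nrm2 h.
Proof.
move=> Le oe Lh.
have e1 k : nrm2 (e k) = 1.
  by have := oe k k; rewrite inner_self eqxx => /(congr1 (@complex.Re R)).
(* The residue [r] keeps the coefficients of [h] against the vectors not yet treated; this
   identifies the coefficient removed at the next step. *)
suff [r [Lr _ nr]] : exists r, [/\ L2 r,
    forall k, (n <= k)%N -> inner r (e k) = inner h (e k) &
    nrm2 r = nrm2 h - \sum_(k < n) cabs (inner h (e k)) ^+ 2].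
  by rewrite -subr_ge0 -nr nrm2_ge0.
elim: n => [|n [r [Lr re nr]]].
  by exists h; split => //; rewrite big_ord0 subr0.
pose c := inner h (e n).
have rn : inner r (e n) = c by rewrite re.
have LN : L2 (fun x => - c * e n x) by exact: L2Z.
have rE : (fun x => r x - c * e n x) = (fun x => r x + - c * e n x).
  by apply/funext => x; rewrite mulNr.
exists (fun x => r x - c * e n x); split.
- by rewrite rE; exact: L2D.
- move=> k nk; rewrite rE innerDl// innerZl// oe ltn_eqF// mulr0 addr0 re//.
  exact: ltnW.
- by rewrite -rn nrm2_sub_proj// rn nr big_ord_recr/= opprD addrA.
Qed.

End SquareIntegrable.

(** * Density of polynomials *)

Section Weierstrass.
Context {R : realType}.
Implicit Types f g : R -> R.

(* The Bernstein polynomial of degree [n] of the values [phi 0, ..., phi n] at the nodes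
   [k / n]; this recursion avoids binomial coefficients. *)
Fixpoint bernstein (n : nat) (phi : nat -> R) : {poly R} :=
  if n is m.+1 then
    'X * bernstein m (fun k => phi k.+1) + (1 - 'X) * bernstein m phi
  else (phi 0%N)%:P.

Lemma bernsteinS n phi (x : R) : (bernstein n.+1 phi).[x] =
  x * (bernstein n (fun k => phi k.+1)).[x] + (1 - x) * (bernstein n phi).[x].
Proof. by rewrite /= !hornerE. Qed.

Lemma le_bernstein n phi psi (x : R) : 0 <= x <= 1 ->
  (forall k, (k <= n)%N -> phi k <= psi k) ->
  (bernstein n phi).[x] <= (bernstein n psi).[x].
Proof.
move=> /andP[x0 x1]; elim: n phi psi => [|n IH] phi psi le.
  by rewrite !hornerC le.
rewrite !bernsteinS lerD// ler_wpM2l ?subr_ge0//; apply: IH => k kn; apply: le => //.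
exact: leqW.
Qed.

(** The value at [x] is the mean of the node values under the binomial law with parameters [n] and
    [x], and [n x (1 - x)] is its variance. The induction varies [c], because shifting the nodes by
    one replaces [c] by [c - 1]. *)
Lemma bernstein_quadratic n (a b c x : R) :
  (bernstein n (fun k => a + b * (k%:R - c) ^+ 2)).[x] =
  a + b * (n%:R * x * (1 - x) + (n%:R * x - c) ^+ 2).
Proof.
elim: n c => [|n IH] c; first by rewrite hornerC !mul0r !add0r.
rewrite bernsteinS.
have -> : (fun k => a + b * (k.+1%:R - c) ^+ 2) =
    (fun k => a + b * (k%:R - (c - 1)) ^+ 2).
  by apply/funext => k; congr (a + b * _ ^+ 2); rewrite -natr1; ring.
by rewrite !IH -natr1; ring.
Qed.

(* Uniform continuity away from the diagonal is absorbed by the quadratic term, which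
   Bernstein polynomials reproduce up to [x (1 - x) / n]. *)
Lemma unit_interval_modulus f (e : R) : continuous f -> 0 < e ->
  exists2 C : R, 0 <= C & forall x s, 0 <= x <= 1 -> 0 <= s <= 1 ->
    `|f s - f x| <= e + C * (s - x) ^+ 2.
Proof.
move=> cf e0.
have [M Mf] : exists M, forall x, 0 <= x <= 1 -> `|f x| <= M.
  have cnf : {within `[0, 1], continuous (fun x => `|f x|)}.
    apply: continuous_subspaceT => x; exact: (continuous_comp (cf x) (@norm_continuous _ _ _)).
  have [c _ Hc] := EVT_max (@ler01 R) cnf.
  by exists `|f c| => x x01; apply: Hc; rewrite in_itv.
have M0 : 0 <= M by apply: le_trans (Mf 0 _); rewrite ?lexx ?ler01.
pose P (C x : R) := forall s, 0 <= s <= 1 -> `|f s - f x| <= e + C * (s - x) ^+ 2.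
(* Compactness in this form yields a single [C] for all [x] from a local choice around each
   point. *)
have : near_covering (`[0, 1]%classic : set R).
  by apply/compact_near_coveringP; exact: segment_compact.
move=> /(_ R (pinfty_nbhs R) (fun C x => 0 <= x <= 1 -> P C x)) H.
have {}H : \forall C \near +oo, `[0, 1] `<=` (fun x => 0 <= x <= 1 -> P C x).
  apply: H => x; rewrite /= in_itv/= => x01.
  have /cvgr_distC_lt/(_ (e / 2)) : f s @[s --> x] --> f x by exact: cf.
  rewrite divr_gt0// => /(_ isT) /nbhs_ballP[d /= d0 xd].
  near=> x' C => x'01 s s01.
  have xx' : `|x - x'| < d / 2.
    by near: x'; apply: cvgr_dist_lt => //; rewrite divr_gt0.
  (* For [s] at distance at least [d / 2] from [x'] the quadratic term then exceeds the trivial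
     bound [2 * M]; for closer [s], both points lie in the ball where [f] varies little. *)
  have C0 : 2 * M / (d / 2) ^+ 2 <= C.
    by near: C; apply: nbhs_pinfty_ge; rewrite num_real.
  have C1 : 0 <= C.
    by apply: le_trans C0; rewrite divr_ge0 ?sqr_ge0// mulr_ge0.
  have [sx|sx] := ltP `|s - x'| (d / 2).
    apply: (@le_trans _ _ e); last by rewrite lerDl mulr_ge0 ?sqr_ge0.
    have -> : f s - f x' = (f s - f x) + (f x - f x') by rewrite addrA subrK.
    apply: le_trans (ler_normD _ _) _; rewrite [leRHS]splitr lerD//.
      apply/ltW/xd; rewrite /ball/=.
      have -> : x - s = (x - x') + (x' - s) by rewrite addrA subrK.
      apply: le_lt_trans (ler_normD _ _) _; rewrite [ltRHS]splitr ltrD//.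
      by rewrite distrC.
    by rewrite distrC; apply/ltW/xd; rewrite /ball/=; move: xx' => /=; lra.
  apply: (@le_trans _ _ (2 * M)).
    by apply: le_trans (ler_normB _ _) _; rewrite mulrDl mul1r lerD// Mf.
  rewrite /= -[leLHS]add0r; apply: lerD; first exact: ltW.
  rewrite ler_pdivrMr ?exprn_gt0 ?divr_gt0// in C0.
  apply: le_trans C0 _; rewrite ler_wpM2l// -[leRHS]real_normK ?num_real//.
  by rewrite ler_sqr ?nnegrE ?divr_ge0// ltW.
have [C [C0 HC]] := filter_ex (filterI (nbhs_pinfty_ge (num_real 0)) H).
exists C => // x s x01 s01; exact: HC.
Unshelve. all: by end_near. Qed.

(** The node values of [f] lie between two quadratics in [k] centred at [n x]. Monotonicity of the
    Bernstein operator preserves these bounds, and the quadratics are evaluated exactly. *)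
Lemma weierstrass01 f (e : R) : continuous f -> 0 < e ->
  exists p : {poly R}, forall x, 0 <= x <= 1 -> `|f x - p.[x]| <= e.
Proof.
move=> cf e0; have e20 : 0 < e / 2 by rewrite divr_gt0.
have [C C0 HC] := unit_interval_modulus cf e20.
(* The variance leaves an error [C x (1 - x) / n], which is at most [C / n], and this [n] makes it
   at most [e / 2]. *)
pose n := (Num.truncn (C / (e / 2))).+1.
have n0 : 0 < n%:R :> R by rewrite ltr0n.
have Cn : C / n%:R <= e / 2.
  rewrite ler_pdivrMr// mulrC -ler_pdivrMr//.
  by apply/ltW; rewrite /n truncnS_gt.
exists (bernstein n (fun k => f (k%:R / n%:R))) => x /andP[x0 x1].
have key (k : nat) : (k <= n)%N ->
    `|f (k%:R / n%:R) - f x| <= e / 2 + C / n%:R ^+ 2 * (k%:R - n%:R * x) ^+ 2.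
  move=> kn; have := HC x (k%:R / n%:R); rewrite x0 x1 => /(_ isT).
  rewrite divr_ge0 ?ler0n//= ler_pdivrMr// mul1r ler_nat => /(_ kn).
  rewrite (_ : C * _ = C / n%:R ^+ 2 * (k%:R - n%:R * x) ^+ 2)//.
  by field; rewrite gt_eqF.
have var : e / 2 + C / n%:R ^+ 2 * (n%:R * x * (1 - x) + (n%:R * x - n%:R * x) ^+ 2) <= e.
  rewrite [leRHS]splitr lerD2l subrr expr0n/= addr0.
  rewrite (_ : _ * _ = C / n%:R * (x * (1 - x))); last by field; rewrite gt_eqF.
  apply: le_trans Cn; rewrite ler_piMr ?divr_ge0//.
  by nra.
have x01 : 0 <= x <= 1 by rewrite x0 x1.
rewrite ler_distlC; apply/andP; split.
- have H : (bernstein n (fun k => f x - e / 2 +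
        (- (C / n%:R ^+ 2)) * (k%:R - n%:R * x) ^+ 2)).[x] <=
      (bernstein n (fun k => f (k%:R / n%:R))).[x].
    apply: le_bernstein => // k /key; rewrite ler_distl => /andP[+ _].
    by rewrite opprD mulNr addrA.
  apply: le_trans H; rewrite bernstein_quadratic.
  by rewrite mulNr -addrA lerD2l -opprD lerN2.
- have H : (bernstein n (fun k => f (k%:R / n%:R))).[x] <=
      (bernstein n (fun k => (f x + e / 2) +
        C / n%:R ^+ 2 * (k%:R - n%:R * x) ^+ 2)).[x].
    apply: le_bernstein => // k /key; rewrite ler_distl => /andP[_].
    by rewrite addrA.
  apply: le_trans H _; rewrite bernstein_quadratic.
  by rewrite -addrA lerD2l.
Qed.

Lemma weierstrass f (B e : R) : continuous f -> 0 < B -> 0 < e ->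
  exists p : {poly R}, forall x, - B <= x <= B -> `|f x - p.[x]| <= e.
Proof.
move=> cf B0 e0.
have cg : continuous (fun t : R => f (2 * B * t - B)).
  move=> t; apply: (@continuous_comp _ _ _ (fun t : R => 2 * B * t - B) f); last exact: cf.
  by apply: continuousB; [exact: mulrl_continuous|exact: cst_continuous].
have [p Hp] := weierstrass01 cg e0.
exists (p \Po ((2 * B)^-1 *: ('X + B%:P))) => x /andP[x1 x2].
have B20 : 0 < 2 * B by rewrite mulr_gt0.
have := Hp ((2 * B)^-1 * (x + B)).
have -> : 2 * B * ((2 * B)^-1 * (x + B)) - B = x by field; rewrite gt_eqF.
rewrite horner_comp (_ : ((2 * B)^-1 *: ('X + B%:P)).[x] = (2 * B)^-1 * (x + B)); last first.
  by rewrite !hornerE.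
apply; rewrite mulr_ge0 ?invr_ge0 ?(ltW B20)//=; last lra.
by rewrite ler_pdivrMl// mulr1; lra.
Qed.

End Weierstrass.

(** * From uniform to mean-square approximation by polynomials *)

Section PolynomialDensity.
Context {R : realType}.
Local Notation mu := (@lebesgue_measure R).
Implicit Types u v w : R -> R.

(** Truncation of [x] to [[-N, N]], written with absolute values so that its properties reduce to
    linear arithmetic and its continuity to that of the norm. *)
Definition clip (N x : R) : R := (`|x + N| - `|x - N|) / 2.

Lemma clip_le (N x : R) : 0 <= N -> `|clip N x| <= N.
Proof.
move=> N0; rewrite ler_norml /clip.
by have [?|?] := ger0P (x + N); have [?|?] := ger0P (x - N); apply/andP; split; lra.
Qed.

Lemma clip_id (N x : R) : `|x| <= N -> clip N x = x.
Proof.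
rewrite ler_norml /clip => /andP[x1 x2].
by have [?|?] := ger0P (x + N); have [?|?] := ger0P (x - N); lra.
Qed.

Lemma clip_dist (N x y : R) : `|clip N x - clip N y| <= `|x - y|.
Proof.
rewrite ler_norml /clip.
have [?|?] := ger0P (x + N); have [?|?] := ger0P (x - N);
have [?|?] := ger0P (y + N); have [?|?] := ger0P (y - N);
have [?|?] := ger0P (x - y); apply/andP; split; lra.
Qed.

Lemma clip_sub (N x : R) : 0 <= N -> (x - clip N x) ^+ 2 <= x ^+ 2.
Proof.
move=> N0; rewrite -[leLHS]real_normK ?num_real// -[leRHS]real_normK ?num_real//.
rewrite ler_sqr ?nnegrE// ler_norml /clip.
have [?|?] := ger0P (x + N); have [?|?] := ger0P (x - N);
have [?|?] := ger0P x; apply/andP; split; lra.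
Qed.

Lemma continuous_clip N : continuous (clip N).
Proof.
move=> x; apply: cvgMl; apply: cvgB; apply: cvg_norm.
  by apply: cvgD; [exact: cvg_id|exact: cvg_cst].
by apply: cvgB; [exact: cvg_id|exact: cvg_cst].
Qed.

Lemma measurable_clip N u : measurable_fun setT u -> measurable_fun setT (fun x => clip N (u x)).
Proof. exact: (measurableT_comp (continuous_measurable_fun (@continuous_clip N))). Qed.

Context (D : set R).
Context (mD : measurable D) (Doo : (mu D < +oo)%E).

Definition dist2 u v : \bar R := (\int[mu]_(x in D) ((u x - v x) ^+ 2)%:E)%E.

Lemma measurable_dist2 u v : measurable_fun setT u -> measurable_fun setT v ->
  measurable_fun D (fun x => ((u x - v x) ^+ 2)%:E).
Proof.
move=> mu' mv; apply/measurable_EFinP/measurable_funX.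
by apply: measurable_funTS; exact: measurable_funB.
Qed.

Lemma dist2_trans v u w (e : R) : measurable_fun setT u -> measurable_fun setT v ->
  measurable_fun setT w ->
  (dist2 u v < (e / 4)%:E)%E -> (dist2 v w < (e / 4)%:E)%E -> (dist2 u w < e%:E)%E.
Proof.
move=> mu' mv mw uv vw.
have -> : e%:E = (2%:E * ((e / 4)%:E + (e / 4)%:E))%E.
  by rewrite -EFinD -EFinM; congr EFin; field.
apply: (@le_lt_trans _ _ (2%:E * (dist2 u v + dist2 v w))%E); last first.
  by rewrite lte_pmul2l// lteD.
rewrite /dist2 -ge0_integralD//; try exact: measurable_dist2;
  try by move=> x _; rewrite lee_fin sqr_ge0.
rewrite -ge0_integralZl//; last 2 first.
- by apply: emeasurable_funD; exact: measurable_dist2.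
- by move=> x _; rewrite adde_ge0// lee_fin sqr_ge0.
apply: ge0_le_integral => //.
- by move=> x _; rewrite lee_fin sqr_ge0.
- exact: measurable_dist2.
- by apply: measurable_funeM; apply: emeasurable_funD; exact: measurable_dist2.
- move=> x _; rewrite -EFinD -EFinM lee_fin.
  by have := sqr_ge0 ((u x - v x) - (v x - w x)); nra.
Qed.

(** Dominated convergence: at each point the truncation is eventually exact, and the squared error
    never exceeds [u^2]. *)
Lemma dist2_clip u (e : R) : measurable_fun setT u -> 0 < e ->
  (\int[mu]_(x in D) (u x ^+ 2)%:E < +oo)%E ->
  exists N : nat, (dist2 u (fun x => clip N%:R (u x)) < e%:E)%E.
Proof.
move=> mu' e0 uoo.
have mu2 : measurable_fun D (fun x => (u x ^+ 2)%:E).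
  by apply/measurable_EFinP/measurable_funX; exact: measurable_funTS.
have iu : mu.-integrable D (fun x => (u x ^+ 2)%:E).
  apply/integrableP; split => //.
  by under eq_integral do rewrite gee0_abs ?lee_fin ?sqr_ge0//.
have [] := @dominated_convergence _ _ _ mu D mD
  (fun N x => ((u x - clip N%:R (u x)) ^+ 2)%:E) (cst 0%E) (fun x => (u x ^+ 2)%:E).
- by move=> N; apply: measurable_dist2 => //; exact: measurable_clip.
- exact: measurable_cst.
- apply: aeW => x _; apply: cvg_near_cst.
  have [m um] : exists m : nat, `|u x| <= m%:R.
    by exists (Num.truncn `|u x|).+1; apply/ltW/truncnS_gt.
  exists m => // n /= mn; rewrite clip_id ?subrr ?expr0n//.
  by apply: le_trans um _; rewrite ler_nat.
- exact: iu.
- by apply: aeW => x N _; rewrite gee0_abs ?lee_fin ?sqr_ge0// clip_sub.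
move=> _ _; rewrite integral0 => /(_ _)H.
have /= := H [set y | (y < e%:E)%E] _.
have : nbhs (0 : \bar R) [set y | (y < e%:E)%E].
  by apply: open_nbhs_nbhs; split; [exact: open_ereal_lt_ereal|rewrite /= lte_fin].
move=> /H [N _ HN]; exists N; exact: HN N (leqnn N).
Qed.

(** Continuous functions are dense for the [L^1] distance. Clipping the approximant to the range of
    [u] does not increase the distance and bounds the difference by [2 N], so the squared error is
    at most [2 N] times the [L^1] error. *)
Lemma dist2_bounded_continuous u (N e : R) : measurable_fun setT u -> 0 < N -> 0 < e ->
  (forall x, `|u x| <= N) ->
  exists g : R -> R, continuous g /\ (dist2 u g < e%:E)%E.
Proof.
move=> mu' N0 e0 uN.
have iu : mu.-integrable D (EFin \o u).
  apply: measurable_bounded_integrable => //; first exact: measurable_funTS.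
  exists N; split; first exact: num_real.
  by move=> M NM x _ /=; apply: le_trans (uN x) (ltW NM).
have [g_ [cg ig gcvg]] := approximation_continuous_integrable mD Doo iu.
have e'0 : 0 < e / (2 * N) by rewrite divr_gt0// mulr_gt0.
have : nbhs (0 : \bar R) [set y | (y < (e / (2 * N))%:E)%E].
  by apply: open_nbhs_nbhs; split; [exact: open_ereal_lt_ereal|rewrite /= lte_fin].
move=> /gcvg [n _ Hn]; have {Hn} := Hn n (leqnn n); rewrite /= => Hn.
have cgn : continuous (fun x => clip N (g_ n x)).
  by move=> x; apply: (continuous_comp (cg n x)); exact: continuous_clip.
have mg : measurable_fun setT (g_ n) := continuous_measurable_fun (cg n).
have mclg := continuous_measurable_fun cgn.
exists (fun x => clip N (g_ n x)); split => //.
have mabs : measurable_fun D (fun x => `|(u x - g_ n x)%:E|%E).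
  apply: measurableT_comp => //; apply/measurable_EFinP.
  by apply: measurable_funTS; exact: measurable_funB.
apply: (@le_lt_trans _ _ ((2 * N)%:E * \int[mu]_(x in D) `|(u x - g_ n x)%:E|)%E).
  rewrite -ge0_integralZl//; last by rewrite lee_fin mulr_ge0// ltW.
  apply: ge0_le_integral => //.
  - by move=> x _; rewrite lee_fin sqr_ge0.
  - exact: measurable_dist2.
  - exact: measurable_funeM.
  - move=> x _; rewrite -EFinM lee_fin -real_normK ?num_real// expr2.
    apply: ler_pM => //; last by rewrite -{1}(clip_id (uN x)) clip_dist.
    rewrite (le_trans (ler_normB _ _))// mulrDl mul1r lerD//.
    by rewrite clip_le// ltW.
have -> : e%:E = ((2 * N)%:E * (e / (2 * N))%:E)%E.
  by rewrite -EFinM; congr EFin; field; rewrite gt_eqF.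
by rewrite lte_pmul2l// lte_fin mulr_gt0.
Qed.

End PolynomialDensity.

Lemma lebesgue_measure_sym_itv (R : realType) (B : R) : 0 <= B ->
  lebesgue_measure (`[(- B)%R, B]%classic : set R) = (2 * B)%:E.
Proof.
move=> B0; rewrite lebesgue_measure_itv/= lte_fin.
case: ifPn => [_|]; first by rewrite -EFinB opprK mulrDl mul1r.
rewrite -leNgt => BB; have -> : B = 0 by lra.
by rewrite mulr0.
Qed.

Lemma poly_dense_L2 (R : realType) (B : R) (u : R -> R) (e : R) : 0 < B ->
  measurable_fun setT u -> 0 < e ->
  (\int[@lebesgue_measure R]_(x in `[(- B)%R, B]) (u x ^+ 2)%:E < +oo)%E ->
  exists p : {poly R}, (dist2 `[(- B)%R, B] u (horner p) < e%:E)%E.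
Proof.
move=> B0 mu' e0 uoo.
have Doo : (lebesgue_measure (`[(- B)%R, B]%classic : set R) < +oo)%E.
  by rewrite lebesgue_measure_sym_itv ?ltry// ltW.
have mD : measurable (`[(- B)%R, B]%classic : set R) by exact: measurable_itv.
have e4 : 0 < e / 4 by rewrite divr_gt0.
have e16 : 0 < e / 4 / 4 by rewrite divr_gt0.
have [N HN] := dist2_clip mD mu' e4 uoo.
have mcl := measurable_clip N%:R mu'.
(* The truncation level [N] may be 0, whereas the next lemma takes a positive bound. *)
have N1 : 0 < N.+1%:R :> R by rewrite ltr0n.
have [|g [cg Hg]] := dist2_bounded_continuous mD Doo mcl N1 e16.
  by move=> x; rewrite (le_trans (clip_le _ _))// ler_nat.
(* A uniform error [d] on an interval of length [2 B] costs [2 B d^2]; with [4 B] in the denominator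
   the result stays strictly below [e / 16]. *)
have d0 : 0 < e / 4 / 4 / (4 * B) by rewrite divr_gt0// mulr_gt0.
have [d d'0 dd] : exists2 d : R, 0 < d & d ^+ 2 <= e / 4 / 4 / (4 * B).
  exists (Num.sqrt (e / 4 / 4 / (4 * B))); first by rewrite sqrtr_gt0.
  by rewrite sqr_sqrtr// ltW.
have [p Hp] := weierstrass cg B0 d'0.
have mp : measurable_fun setT (horner p).
  exact: continuous_measurable_fun (@continuous_horner _ p).
have mg := continuous_measurable_fun cg.
exists p; apply: (dist2_trans mD mu' mcl) => //.
apply: (dist2_trans mD mcl mg) => //.
apply: (@le_lt_trans _ _ (\int[@lebesgue_measure R]_(x in `[(- B)%R, B]) (d ^+ 2)%:E)%E).
  apply: ge0_le_integral => //.
  - by move=> x _; rewrite lee_fin sqr_ge0.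
  - exact: measurable_dist2.
  - move=> x; rewrite /= in_itv/= => /Hp h; rewrite lee_fin -[leLHS]real_normK ?num_real//.
    by rewrite ler_sqr ?nnegrE// ltW.
apply: (@le_lt_trans _ _ ((d ^+ 2)%:E * (2 * B)%:E)%E).
  by rewrite integral_cst// -lebesgue_measure_sym_itv// ltW.
rewrite -EFinM lte_fin.
have -> : e / 4 / 4 = (e / 4 / 4 / (4 * B)) * (4 * B) by field; rewrite gt_eqF.
apply: (@le_lt_trans _ _ (e / 4 / 4 / (4 * B) * (2 * B))).
  by rewrite ler_wpM2r// mulr_ge0// ltW.
by rewrite ltr_pM2l//; lra.
Qed.

(** * Band-limited multipliers *)

Section ExponentialEstimates.
Context {R : realType}.

Lemma mean_value0 (f df : R -> R) (t : R) :
  (forall x, is_derive x (1 : R) f (df x)) ->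
  exists2 c, `|c| <= `|t| & f t - f 0 = df c * t.
Proof.
move=> fdf.
have cf : continuous f.
  by move=> x; apply: differentiable_continuous; apply/derivable1_diffP; have [] := fdf x.
have [t0|t0] := leP 0 t.
  have [c] := MVT_segment t0 (fun x _ => fdf x) (continuous_subspaceT cf).
  rewrite in_itv/= => /andP[c0 ct] ->; exists c; last by rewrite subr0.
  by rewrite !ger0_norm.
have [c] := MVT_segment (ltW t0) (fun x _ => fdf x) (continuous_subspaceT cf).
rewrite in_itv/= => /andP[c0 ct] H; exists c.
  by rewrite (ler0_norm ct) (ltr0_norm t0) lerN2.
by rewrite -[LHS]opprB H sub0r mulrN opprK.
Qed.

Lemma norm_sin_le (t : R) : `|sin t| <= `|t|.
Proof.
have [c _] := mean_value0 t (@is_derive_sin R).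
by rewrite sin0 subr0 => ->; rewrite normrM ler_piMl// cos_max.
Qed.

Lemma norm_cosB1_le (t : R) : `|cos t - 1| <= `|t|.
Proof.
have [c _] := mean_value0 t (@is_derive_cos R).
by rewrite cos0 => ->; rewrite normrM ler_piMl// normrN sin_max.
Qed.

Lemma norm_cosB1_le2 (t : R) : `|cos t - 1| <= t ^+ 2.
Proof.
have [c ct] := mean_value0 t (@is_derive_cos R).
rewrite cos0 => ->; rewrite normrM normrN -[leRHS]real_normK ?num_real// expr2.
by rewrite ler_wpM2r// (le_trans (norm_sin_le _)).
Qed.

(** The mean value theorem leaves [cos c - 1] as a factor, which is itself at most [|c|]. This crude
    quadratic remainder suffices for a limit as the frequency tends to 0. *)
Lemma norm_sinB_le2 (t : R) : `|sin t - t| <= t ^+ 2.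
Proof.
have dsin (x : R) : is_derive x (1 : R) (fun y => sin y - y) (cos x - 1).
  exact: is_deriveB.
have [c ct] := mean_value0 t dsin.
rewrite sin0 !subr0 => ->; rewrite normrM -[leRHS]real_normK ?num_real// expr2.
by rewrite ler_wpM2r// (le_trans (norm_cosB1_le _)).
Qed.

Lemma cabs_expi2piB1 (u : R) : cabs (expi2pi u - 1) <= 4 * pi * `|u|.
Proof.
apply: le_trans (cabs_le _) _.
have -> : 4 * pi * `|u| = `|2 * pi * u| + `|2 * pi * u|.
  rewrite normrM [`|2 * pi|]ger0_norm ?mulr_ge0 ?pi_ge0//; ring.
by rewrite ReD ImD /= oppr0 addr0 lerD ?norm_cosB1_le ?norm_sin_le.
Qed.

Lemma cabs_expi2piB (u v : R) : cabs (expi2pi u - expi2pi v) <= 4 * pi * `|u - v|.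
Proof.
have -> : expi2pi u - expi2pi v = expi2pi v * (expi2pi (u - v) - 1).
  by rewrite mulrBr mulr1 -expi2piD [v + _]addrC subrK.
by rewrite cabsM cabs_expi2pi mul1r cabs_expi2piB1.
Qed.

Lemma cabs_expi2pi_taylor (u : R) :
  cabs (expi2pi u - 1 - Complex 0 (2 * pi * u)) <= 2 * (2 * pi * u) ^+ 2.
Proof.
apply: le_trans (cabs_le _) _.
rewrite (_ : 2 * (2 * pi * u) ^+ 2 = (2 * pi * u) ^+ 2 + (2 * pi * u) ^+ 2); last by ring.
rewrite !ReD !ImD /= !oppr0 !addr0.
by rewrite lerD ?norm_cosB1_le2 ?norm_sinB_le2.
Qed.

End ExponentialEstimates.

(** Measurability of functions defined by integrals, such as [sinc] and [box_inner], is derived from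
    explicit Lipschitz bounds. *)
Lemma lipschitz_cmfun (R : realType) (f : R -> R[i]) (K : R) :
  (forall x y, cabs (f x - f y) <= K * `|x - y|) -> cmfun f.
Proof.
move=> fK.
have H (h : R -> R) : (forall x y, `|h x - h y| <= K * `|x - y|) -> measurable_fun setT h.
  move=> hK; apply: continuous_measurable_fun => x; apply/cvgrPdist_le => e e0.
  (* The constant [K] need not be positive, and the next steps divide by it. *)
  have K1 : 0 < `|K| + 1 by rewrite ltr_wpDl.
  near=> y; apply: le_trans (hK _ _) _.
  apply: (@le_trans _ _ ((`|K| + 1) * `|x - y|)).
    by rewrite ler_wpM2r// (le_trans (ler_norm _))// lerDl.
  rewrite mulrC -ler_pdivlMr//; near: y.
  by apply: cvgr_dist_le => //; rewrite divr_gt0.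
split; apply: H => x y; apply: le_trans (fK x y).
  by rewrite -ReN -ReD cabs_Re.
by rewrite -ImN -ImD cabs_Im.
Unshelve. all: by end_near. Qed.

Lemma cmfun_expi2pi (R : realType) : cmfun (@expi2pi R).
Proof. exact: (lipschitz_cmfun (@cabs_expi2piB R)). Qed.

Section BoxKernel.
Context {R : realType}.
Local Notation mu := (@lebesgue_measure R).
Local Notation Re := complex.Re.
Local Notation Im := complex.Im.

Definition box (d : R) (t : R) : R := (2 * d)^-1 * \1_`[(- d)%R, d] t.

Definition cbox (d : R) (t : R) : R[i] := (box d t)%:C%C.

Context (d : R).
Context (d0 : 0 < d).

Lemma box_ge0 t : 0 <= box d t.
Proof. by rewrite mulr_ge0// invr_ge0 mulr_ge0// ltW. Qed.

Lemma box_out t : ~ (- d <= t <= d) -> box d t = 0.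
Proof. by move=> td; rewrite /box indicE memNset ?mulr0//= in_itv. Qed.

Lemma measurable_box : measurable_fun setT (box d).
Proof. by apply: measurable_funM => //; apply: measurable_indic; exact: measurable_itv. Qed.

Lemma cabs_cbox t : cabs (cbox d t) = box d t.
Proof. by rewrite cabsR ger0_norm// box_ge0. Qed.

Lemma cmfun_cbox : cmfun (cbox d).
Proof. by apply: cmfunR; exact: measurable_box. Qed.

Lemma integral_box : (\int[mu]_t (box d t)%:E = 1)%E.
Proof.
rewrite /box; under eq_integral do rewrite EFinM.
rewrite ge0_integralZl//; last by rewrite lee_fin invr_ge0 mulr_ge0// ltW.
- rewrite integral_indic//= setIT lebesgue_measure_sym_itv ?ltW//.
  by rewrite -EFinM mulVf// gt_eqF// mulr_gt0.
- by apply/measurable_EFinP; apply: measurable_indic; exact: measurable_itv.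
Qed.

Lemma integrable_box : mu.-integrable setT (EFin \o box d).
Proof.
apply/integrableP; split; first by apply/measurable_EFinP; exact: measurable_box.
under eq_integral do rewrite /= ger0_norm ?box_ge0//.
by rewrite integral_box ltry.
Qed.

Lemma Rintegral_box : \int[mu]_t box d t = 1.
Proof. by rewrite /Rintegral integral_box. Qed.

Lemma cintegrable_cbox : cintegrable (cbox d).
Proof. by apply: (cintegrable_le cmfun_cbox integrable_box) => t; rewrite cabs_cbox. Qed.

Lemma cintegral_cbox : cintegral (cbox d) = 1.
Proof.
apply: complex_ext => /=; first exact: Rintegral_box.
by rewrite /Rintegral integral0.
Qed.

Lemma cbox_bound (f : R -> R[i]) (K : R) :
  (forall t, - d <= t <= d -> cabs (f t) <= K) ->
  forall t, cabs (cbox d t * f t) <= K * box d t.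
Proof.
move=> fK t; rewrite cabsM cabs_cbox mulrC.
have [td|td] := boolP (- d <= t <= d); first by rewrite ler_wpM2r ?box_ge0// fK.
by rewrite box_out ?mulr0//; exact/negP.
Qed.

Lemma cintegrable_cboxM (f : R -> R[i]) (K : R) : cmfun f ->
  (forall t, - d <= t <= d -> cabs (f t) <= K) ->
  cintegrable (fun t => cbox d t * f t).
Proof.
move=> mf fK; apply: (cintegrable_le _ _ (cbox_bound fK)).
  exact: (cmfunM cmfun_cbox mf).
exact: (integrableZl measurableT K integrable_box).
Qed.

Lemma cabs_cintegral_cboxM (f : R -> R[i]) (K : R) : cmfun f ->
  (forall t, - d <= t <= d -> cabs (f t) <= K) ->
  cabs (cintegral (fun t => cbox d t * f t)) <= 2 * K.
Proof.
move=> mf fK.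
have iK := integrableZl measurableT K integrable_box.
have := cabs_cintegral_le (cmfunM cmfun_cbox mf) iK (cbox_bound fK).
rewrite RintegralZl//; last exact: integrable_box.
by rewrite Rintegral_box mulr1.
Qed.

End BoxKernel.

(** * The cardinal sine: slow variation near 0 and square-integrability *)

Section Sinc.
Context {R : realType}.
Local Notation mu := (@lebesgue_measure R).
Local Notation Re := complex.Re.
Local Notation Im := complex.Im.
Context (g : R).
Context (g0 : 0 < g).

(** This is [sin(2 pi g x) / (2 pi g x)], with value 1 at 0. The integral form avoids the
    singularity and displays the spectrum [[-g, g]], which is read off when the spreading function
    is computed. *)
Definition sinc (x : R) : R[i] := cintegral (fun nu => cbox g nu * expi2pi (x * nu)).

Lemma cmfun_expi2piM (x : R) : cmfun (fun nu => expi2pi (x * nu)).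
Proof.
by apply: (cmfun_comp (@cmfun_expi2pi R)); apply: measurable_funM.
Qed.

Lemma sinc_cintegrable (x : R) : cintegrable (fun nu => cbox g nu * expi2pi (x * nu)).
Proof.
apply: (@cintegrable_cboxM _ _ g0 _ 1) => [|nu _]; last by rewrite cabs_expi2pi.
exact: cmfun_expi2piM.
Qed.

Lemma cabs_sinc (x : R) : cabs (sinc x) <= 2.
Proof.
rewrite -[leRHS]mulr1; apply: cabs_cintegral_cboxM => // [|nu _].
  exact: cmfun_expi2piM.
by rewrite cabs_expi2pi.
Qed.

(** The constant is proportional to [g], so together with [sinc0] a small [g] brings [sinc] close to
    1 on a given interval. *)
Lemma sinc_lipschitz (x y : R) : cabs (sinc x - sinc y) <= 8 * pi * g * `|x - y|.
Proof.
have -> : sinc x - sinc y =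
    cintegral (fun nu => cbox g nu * (expi2pi (x * nu) - expi2pi (y * nu))).
  rewrite /sinc -[- cintegral _]mulN1r -cintegralZ; last exact: sinc_cintegrable.
  rewrite -cintegralD; last 2 first.
  - exact: sinc_cintegrable.
  - exact/cintegrableZ/sinc_cintegrable.
  by apply: eq_cintegral => nu; rewrite mulN1r mulrBr.
have -> : 8 * pi * g * `|x - y| = 2 * (4 * pi * (`|x - y| * g)) by ring.
apply: cabs_cintegral_cboxM => // [|nu /andP[nu1 nu2]].
  by apply: cmfunB; exact: cmfun_expi2piM.
apply: le_trans (cabs_expi2piB _ _) _; rewrite -mulrBl normrM.
rewrite ler_wpM2l ?mulr_ge0 ?pi_ge0// ler_wpM2l// ler_norml; apply/andP; split; lra.
Qed.

Lemma cmfun_sinc : cmfun sinc.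
Proof. exact: (lipschitz_cmfun sinc_lipschitz). Qed.

Lemma sinc0 : sinc 0 = 1.
Proof.
rewrite /sinc -(cintegral_cbox g0); apply: eq_cintegral => nu.
by rewrite mul0r expi2pi0 mulr1.
Qed.

Lemma Rintegral_boxM (f F : R -> R) : (forall x, is_derive x (1 : R) F (f x)) ->
  continuous f -> \int[mu]_t (box g t * f t) = (2 * g)^-1 * (F g - F (- g)).
Proof.
move=> dF cf.
have cF : continuous F.
  by move=> x; apply: differentiable_continuous; apply/derivable1_diffP; have [] := dF x.
have gg : - g < g by rewrite (lt_trans _ g0)// oppr_lt0.
have icf : mu.-integrable `[- g, g] (EFin \o f).
  apply: continuous_compact_integrable; first exact: segment_compact.
  exact: continuous_subspaceT.
have := @continuous_FTC2 R f F _ _ gg (continuous_subspaceT cf).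
move=> /(_ _ _)FTC.
transitivity (\int[mu]_(t in `[- g, g]) ((2 * g)^-1 * f t)).
  rewrite [RHS]Rintegral_mkcond; apply: eq_Rintegral => t _.
  by rewrite patchE /box indicE; case: ifP => _; rewrite ?mulr1// mulr0 mul0r.
rewrite RintegralZl//; congr (_ * _); rewrite /Rintegral FTC//.
- split; first by move=> x _; have [] := dF x.
  + exact/cvg_at_right_filter/cF.
  + exact/cvg_at_left_filter/cF.
- by move=> x _; rewrite derive1E; have [_ ->] := dF x.
Qed.

(** The integral is computed by antiderivatives: the sine part contributes [sin(w g) / (w g)] with
    [w = 2 pi x], and the imaginary part cancels because the cosine is even. *)
Lemma sinc_decay (x : R) : `|x| * cabs (sinc x) <= (2 * pi * g)^-1.
Proof.
have pi0 := pi_gt0 R.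
have RHS0 : 0 <= (2 * pi * g)^-1 by rewrite invr_ge0 !mulr_ge0// ltW.
have [->|x0] := eqVneq x 0; first by rewrite normr0 mul0r.
pose w := 2 * pi * x.
have w0 : w != 0 by rewrite !mulf_neq0// gt_eqF.
have dl (t : R) : is_derive t (1 : R) (fun t => w * t) w.
  have := is_deriveZ w (is_derive_id t (1 : R)).
  by rewrite /GRing.scale/= mulr1.
have dsin (t : R) : is_derive t (1 : R) (fun t => w^-1 * sin (w * t)) (cos (w * t)).
  have H := is_derive1_comp (is_derive_sin (w * t)) (dl t).
  have := is_deriveZ w^-1 H.
  by rewrite /GRing.scale/= mulrCA mulVf// mulr1.
have dcos (t : R) : is_derive t (1 : R) (fun t => w^-1 * - cos (w * t)) (sin (w * t)).
  have H := is_deriveN (is_derive1_comp (is_derive_cos (w * t)) (dl t)).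
  have := is_deriveZ w^-1 H.
  by rewrite /GRing.scale/= mulNr opprK mulrCA mulVf// mulr1.
have cw : continuous (fun t : R => w * t) by exact: mulrl_continuous.
have ReE : Re (sinc x) = (2 * g)^-1 * (w^-1 * sin (w * g) - w^-1 * sin (w * - g)).
  rewrite -(Rintegral_boxM dsin); last first.
    by move=> t; apply: (continuous_comp (cw t)); exact: continuous_cos.
  rewrite -[LHS]/(\int[mu]_nu Re (cbox g nu * expi2pi (x * nu))).
  by apply: eq_Rintegral => t _; rewrite ReM /= mul0r subr0 mulrA.
have ImE : Im (sinc x) = 0.
  have -> : Im (sinc x) = (2 * g)^-1 * (w^-1 * - cos (w * g) - w^-1 * - cos (w * - g)).
    rewrite -(Rintegral_boxM dcos); last first.
      by move=> t; apply: (continuous_comp (cw t)); exact: continuous_sin.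
    rewrite -[LHS]/(\int[mu]_nu Im (cbox g nu * expi2pi (x * nu))).
    by apply: eq_Rintegral => t _; rewrite ImM /= mul0r addr0 mulrA.
  by rewrite (mulrN w) cosN subrr mulr0.
apply: (@le_trans _ _ (`|x| * `|Re (sinc x)|)).
  by rewrite ler_wpM2l// (le_trans (cabs_le _))// ImE normr0 addr0.
rewrite -normrM ReE (mulrN w) sinN mulrN opprK.
have -> : x * ((2 * g)^-1 * (w^-1 * sin (w * g) + w^-1 * sin (w * g))) =
          (2 * pi * g)^-1 * sin (w * g).
  move: (sin _) => S; rewrite /w; move: (@pi R) pi0 => p p0.
  by field; rewrite x0 (gt_eqF p0) (gt_eqF g0).
by rewrite normrM (ger0_norm RHS0) ler_piMr// sin_max.
Qed.

Lemma integral_oneDsqr_lty : (\int[mu]_x ((oneDsqr x)^-1)%:E < +oo :> \bar R)%E.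
Proof.
rewrite (@ge0_symfun_integralT R (fun x => (oneDsqr x)^-1)).
- by rewrite -set_itvcy integral0y_oneDsqr -EFinM ltry.
- by move=> x; rewrite invr_ge0 addr_ge0 ?sqr_ge0.
- exact: continuous_oneDsqrV.
- by move=> x; rewrite /= /oneDsqr sqrrN.
Qed.

(** The two bounds, squared and added, give [|f(x)|^2 (1 + x^2) <= 2 K^2]. *)
Lemma L2_decay (f : R -> R[i]) (K : R) : cmfun f ->
  (forall x, cabs (f x) <= K) -> (forall x, `|x| * cabs (f x) <= K) -> L2 f.
Proof.
move=> mf f1 f2; apply/L2P; split => //.
have K0 : 0 <= K := le_trans (cabs_ge0 _) (f1 0).
apply: (@le_lt_trans _ _ (\int[mu]_x ((2 * K ^+ 2)%:E * ((oneDsqr x)^-1)%:E))%E).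
  apply: ge0_le_integral => //.
  - by move=> x _; rewrite lee_fin sqr_ge0.
  - exact: measurable_cabs2.
  - apply: measurable_funeM; apply/measurable_EFinP.
    exact: (continuous_measurable_fun (@continuous_oneDsqrV R)).
  - move=> x _; rewrite -EFinM lee_fin ler_pdivlMr ?oneDsqr_gt0//.
    rewrite /oneDsqr mulrDr mulr1 mulrDl mul1r lerD//.
      by rewrite ler_sqr ?nnegrE ?cabs_ge0.
    rewrite -[x ^+ 2]real_normK ?num_real// -exprMn mulrC.
    by rewrite ler_sqr ?nnegrE ?mulr_ge0 ?cabs_ge0.
rewrite ge0_integralZl//.
- by rewrite lte_mul_pinfty ?lee_fin ?mulr_ge0 ?sqr_ge0// integral_oneDsqr_lty.
- apply/measurable_EFinP; exact: (continuous_measurable_fun (@continuous_oneDsqrV R)).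
- by rewrite lee_fin mulr_ge0 ?sqr_ge0.
Qed.

Lemma L2_sinc : L2 sinc.
Proof.
apply: (@L2_decay _ (2 + (2 * pi * g)^-1)); first exact: cmfun_sinc.
- move=> x; apply: le_trans (cabs_sinc x) _.
  by rewrite lerDl invr_ge0 !mulr_ge0 ?pi_ge0// ltW.
- by move=> x; apply: le_trans (sinc_decay x) _; rewrite lerDr.
Qed.

End Sinc.

Section TrigonometricApproximation.
Context {R : realType}.
Local Notation mu := (@lebesgue_measure R).
Local Notation Re := complex.Re.
Local Notation Im := complex.Im.

(** Transfers the error of [slow] as an approximation of [x] to [P] evaluated at it. *)
Lemma horner_lipschitz (P : {poly R[i]}) (A : R) : 0 <= A ->
  exists2 L, 0 <= L & forall z w : R[i], cabs z <= A -> cabs w <= A ->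
    cabs (P.[z] - P.[w]) <= L * cabs (z - w).
Proof.
move=> A0; elim/poly_ind: P => [|p c [L L0 HL]].
  by exists 0 => // z w _ _; rewrite !horner0 subr0 cabs0 mul0r.
exists (L * A + cabs p.[0] + L * A) => [|z w zA wA].
  by rewrite !addr_ge0 ?mulr_ge0 ?cabs_ge0.
rewrite !hornerE.
have -> : p.[z] * z + c - (p.[w] * w + c) = p.[z] * (z - w) + (p.[z] - p.[w]) * w.
  by ring.
apply: le_trans (cabsD _ _) _; rewrite !cabsM mulrDl lerD//.
  rewrite ler_wpM2r ?cabs_ge0//.
  have -> : p.[z] = (p.[z] - p.[0]) + p.[0] by rewrite subrK.
  apply: le_trans (cabsD _ _) _; rewrite lerD2r.
  apply: le_trans (HL z 0 zA _) _; first by rewrite cabs0.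
  by rewrite subr0 ler_wpM2l.
rewrite -mulrA [A * _]mulrC mulrA ler_pM ?cabs_ge0//.
exact: HL.
Qed.

Definition trig_poly (delta : R) (Q : {poly R[i]}) (x : R) : R[i] := Q.[expi2pi (delta * x)].

Lemma trig_polyE delta Q x :
  trig_poly delta Q x = \sum_(k < size Q) Q`_k * expi2pi (x * (k%:R * delta)).
Proof.
rewrite /trig_poly horner_coef; apply: eq_bigr => k _.
by rewrite expi2piX mulrA [x * _]mulrC.
Qed.

Lemma cmfun_trig_poly delta Q : cmfun (trig_poly delta Q).
Proof.
rewrite (_ : trig_poly delta Q = fun x => \sum_(k < size Q) Q`_k * expi2pi (x * (k%:R * delta))).
  apply: cmfun_sum => k; apply: cmfunM; first exact: cmfun_cst.
  by apply: (cmfun_comp (@cmfun_expi2pi R)); apply: measurable_funM.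
by apply/funext => x; rewrite trig_polyE.
Qed.

Lemma trig_poly_bounded delta Q : exists2 M, 0 <= M & forall x, cabs (trig_poly delta Q x) <= M.
Proof.
exists (\sum_(k < size Q) cabs Q`_k).
  by apply: sumr_ge0 => k _; exact: cabs_ge0.
move=> x; rewrite trig_polyE; apply: le_trans (cabs_sum _ _ _) _.
by apply: ler_sum => k _; rewrite cabsM cabs_expi2pi mulr1.
Qed.

(* [(e(delta x) - 1) / (2 pi i delta)] tends to [x] as [delta] tends to [0], so that
   polynomials are limits of trigonometric polynomials with arbitrarily low frequencies *)
Definition slow (delta : R) : {poly R[i]} := (Complex 0 (- (2 * pi * delta)^-1)) *: ('X - 1%:P).

Lemma slow_approx (delta x : R) : 0 < delta ->
  cabs ((slow delta).[expi2pi (delta * x)] - x%:C%C) <= 4 * pi * delta * x ^+ 2.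
Proof.
move=> d0; have pi0 := pi_gt0 R.
have w0 : 0 < 2 * pi * delta by rewrite !mulr_gt0.
rewrite /slow hornerZ hornerXsubC.
set k := Complex _ _.
(* Here [k = 1 / (2 pi i delta)], so the linear Taylor term of the exponential yields exactly [x],
   and only the quadratic remainder divided by [2 pi delta] is left. *)
have kx : k * Complex 0 (2 * pi * (delta * x)) = x%:C%C.
  apply: complex_ext; rewrite ?ReM ?ImM /=.
    by move: (@pi R) pi0 => p p0; field; rewrite (gt_eqF p0) (gt_eqF d0).
  by rewrite mul0r mulr0 addr0.
rewrite -kx -mulrBr cabsM.
have -> : cabs k = (2 * pi * delta)^-1.
  apply/eqP; rewrite -(@eqrXn2 _ 2) ?cabs_ge0 ?invr_ge0 ?(ltW w0)// cabs2 /=.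
  by rewrite expr0n/= add0r sqrrN.
rewrite mulrC ler_pdivrMr//; apply: le_trans (cabs_expi2pi_taylor _) _.
by rewrite le_eqVlt; apply/orP; left; apply/eqP; ring.
Qed.

(** The bound does not involve [delta], so once [P] is fixed a small [delta] pushes all frequencies
    [k * delta] below any given level. *)
Lemma size_comp_slow (P : {poly R[i]}) (delta : R) : (size (P \Po slow delta) <= (size P).+1)%N.
Proof.
apply: leq_trans (size_comp_poly_leq _ _) _; rewrite ltnS.
have s2 : ((size (slow delta)).-1 <= 1)%N.
  have := size_scale_leq (Complex 0 (- (2 * pi * delta)^-1)) ('X - 1%:P).
  by rewrite size_XsubC; case: (size _) => [|[|[]]].
apply: (@leq_trans ((size P).-1 * 1)); first by rewrite leq_mul2l s2 orbT.
by rewrite muln1 leq_pred.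
Qed.

(** The condition on [k] says that the spectrum of each modulated cardinal sine, the interval
    [[-g, g]] moved by [k * delta], lies in [[-beta, beta]]. *)
Lemma trig_dense (B beta e : R) (y : R -> R[i]) : 0 < B -> 0 < beta -> 0 < e ->
  cmfun y -> (\int[mu]_(x in `[(- B)%R, B]) (cabs (y x) ^+ 2)%:E < +oo)%E ->
  exists (g delta : R) (Q : {poly R[i]}), [/\ 0 < g,
    forall k, (k < size Q)%N -> `|k%:R * delta| + g <= beta &
    (\int[mu]_(x in `[(- B)%R, B])
       (cabs (trig_poly delta Q x * sinc g x - y x) ^+ 2)%:E < e%:E)%E].
Proof.
move=> B0 b0 e0 my yoo; have pi0 := pi_gt0 R.
have mD : measurable (`[(- B)%R, B]%classic : set R) by exact: measurable_itv.
have [my1 my2] := my.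
have part_lty (h : R -> R) : measurable_fun setT h -> (forall x, h x ^+ 2 <= cabs (y x) ^+ 2) ->
    (\int[mu]_(x in `[(- B)%R, B]) (h x ^+ 2)%:E < +oo)%E.
  move=> mh hy; apply: le_lt_trans yoo; apply: ge0_le_integral => //.
  - by move=> x _; rewrite lee_fin sqr_ge0.
  - by apply: measurable_funTS; apply/measurable_EFinP/measurable_funX.
  - by apply: measurable_funTS; exact: measurable_cabs2.
  - by move=> x _; rewrite lee_fin.
have e8 : 0 < e / 8 by rewrite divr_gt0.
have [|p1 Hp1] := poly_dense_L2 B0 my1 e8.
  by apply: part_lty => // x; rewrite cabs2 lerDl sqr_ge0.
have [|p2 Hp2] := poly_dense_L2 B0 my2 e8.
  by apply: part_lty => // x; rewrite cabs2 lerDr sqr_ge0.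
pose P : {poly R[i]} := map_poly (real_complex R) p1 +
  (Complex 0 1) *: map_poly (real_complex R) p2.
have PE (x : R) : P.[x%:C%C] = Complex p1.[x] p2.[x].
  rewrite /P hornerD hornerZ !horner_map /=.
  by apply: complex_ext; rewrite ?ReD ?ImD ?ReM ?ImM /=; ring.
(* The radius [B + 1] leaves room for [slow], whose value will be within distance 1 of [x]. *)
have [L L0 HL] := @horner_lipschitz P (B + 1) (addr_ge0 (ltW B0) ler01).
pose M := L * B + cabs P.[0].
have M0 : 0 <= M by rewrite addr_ge0 ?cabs_ge0// mulr_ge0// ltW.
have PM (x : R) : - B <= x <= B -> cabs P.[x%:C%C] <= M.
  move=> xB; have xB' : cabs x%:C%C <= B by rewrite cabsR ler_norml.
  rewrite (_ : P.[x%:C%C] = (P.[x%:C%C] - P.[0]) + P.[0]); last by rewrite subrK.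
  apply: le_trans (cabsD _ _) _; rewrite lerD2r.
  apply: le_trans (HL _ _ _ _) _.
  - by rewrite (le_trans xB')// lerDl.
  - by rewrite cabs0 addr_ge0// ltW.
  - by rewrite subr0 ler_wpM2l.
(* A uniform error [a] on [[-B, B]] has squared norm at most [2 B a^2 = e / 8]. *)
pose a := Num.sqrt (e / (16 * B)).
have a0 : 0 < a by rewrite sqrtr_gt0 divr_gt0// mulr_gt0.
have a2 : a ^+ 2 = e / (16 * B) by rewrite sqr_sqrtr// divr_ge0 ?mulr_ge0 ?ltW.
(* the constraints on [delta] are added up, so that [delta = Cd^-1] satisfies all of
   them; likewise for [g] *)
pose Cd := 1 + 2 / beta * (size P).+1%:R + 4 * pi * B ^+ 2 + 16 * pi * L * B ^+ 2 / a.
pose Cg := 1 + 2 / beta + 16 * pi * M * B / a.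
have t1 : 0 <= 2 / beta * (size P).+1%:R by rewrite !mulr_ge0 ?invr_ge0 ?ler0n// ltW.
have t2 : 0 <= 4 * pi * B ^+ 2 by rewrite !mulr_ge0 ?sqr_ge0// ltW.
have t3 : 0 <= 16 * pi * L * B ^+ 2 / a by rewrite !mulr_ge0 ?invr_ge0 ?sqr_ge0// ltW.
have t4 : 0 <= 2 / beta by rewrite !mulr_ge0 ?invr_ge0// ltW.
have t5 : 0 <= 16 * pi * M * B / a by rewrite !mulr_ge0 ?invr_ge0// ltW.
have Cd0 : 0 < Cd by rewrite /Cd; lra.
have Cg0 : 0 < Cg by rewrite /Cg; lra.
pose delta := Cd^-1; pose g := Cg^-1.
have d0 : 0 < delta by rewrite invr_gt0.
have g0 : 0 < g by rewrite invr_gt0.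
have le1 (C c t u : R) : 0 < C -> 0 < u -> t / u <= C -> C^-1 * t <= u.
  by move=> C0 u0 h; rewrite mulrC ler_pdivrMr// -ler_pdivrMl// mulrC.
(* The constraints are: [d1] and [g1] share [beta] between the frequencies and the width of the
   spectrum, [d2] keeps [slow] within distance 1 of [x], and [d3] and [g2] each spend half of [a],
   on replacing [x] by [slow] and 1 by [sinc]. *)
have d1 : delta * (size P).+1%:R <= beta / 2.
  by apply: le1 => //; [rewrite divr_gt0|rewrite invf_div mulrC /Cd; lra].
have d2 : delta * (4 * pi * B ^+ 2) <= 1.
  by apply: le1 => //; rewrite divr1 /Cd; lra.
have d3 : delta * (8 * pi * L * B ^+ 2) <= a / 2.
  apply: le1 => //; first by rewrite divr_gt0.
  rewrite (_ : _ / _ = 16 * pi * L * B ^+ 2 / a); last by field; rewrite gt_eqF.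
  by rewrite /Cd; lra.
have g1 : g <= beta / 2.
  by rewrite -[g]mulr1; apply: le1 => //; [rewrite divr_gt0|rewrite div1r invf_div /Cg; lra].
have g2 : g * (8 * pi * M * B) <= a / 2.
  apply: le1 => //; first by rewrite divr_gt0.
  rewrite (_ : _ / _ = 16 * pi * M * B / a); last by field; rewrite gt_eqF.
  by rewrite /Cg; lra.
exists g, delta, (P \Po slow delta); split => //.
  move=> k kQ; rewrite ger0_norm ?mulr_ge0 ?(ltW d0)// [leRHS]splitr lerD//.
  apply: le_trans d1; rewrite mulrC ler_wpM2l ?(ltW d0)// ler_nat.
  by apply: leq_trans (ltnW kQ) _; exact: size_comp_slow.
have close (x : R) : - B <= x <= B ->
    cabs (trig_poly delta (P \Po slow delta) x * sinc g x - P.[x%:C%C]) <= a.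
  move=> xB; rewrite /trig_poly horner_comp; set z := (slow delta).[_].
  have xB' : cabs x%:C%C <= B by rewrite cabsR ler_norml.
  have x2 : x ^+ 2 <= B ^+ 2.
    by rewrite -[leLHS]real_normK ?num_real// -cabsR ler_sqr ?nnegrE ?cabs_ge0// ltW.
  have zx : cabs (z - x%:C%C) <= 4 * pi * delta * B ^+ 2.
    by apply: le_trans (slow_approx _ d0) _; rewrite ler_wpM2l// !mulr_ge0// ltW.
  have zA : cabs z <= B + 1.
    rewrite (_ : z = x%:C%C + (z - x%:C%C)); last by rewrite addrC subrK.
    apply: le_trans (cabsD _ _) _; rewrite lerD// (le_trans zx)//.
    by rewrite (_ : _ * _ = delta * (4 * pi * B ^+ 2))//; ring.
  rewrite (_ : _ - _ = (P.[z] - P.[x%:C%C]) * sinc g x + P.[x%:C%C] * (sinc g x - 1)); last by ring.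
  apply: le_trans (cabsD _ _) _; rewrite [leRHS]splitr !cabsM lerD//.
    apply: le_trans d3.
    apply: (@le_trans _ _ (L * (4 * pi * delta * B ^+ 2) * 2)).
      apply: ler_pM; rewrite ?cabs_ge0 ?cabs_sinc//.
      apply: le_trans (HL _ _ zA _) _; first by rewrite (le_trans xB')// lerDl.
      by rewrite ler_wpM2l.
    by rewrite le_eqVlt; apply/orP; left; apply/eqP; ring.
  apply: le_trans g2.
  apply: (@le_trans _ _ (M * (8 * pi * g * B))).
    apply: ler_pM; rewrite ?cabs_ge0 ?PM//.
    rewrite -(sinc0 g0); apply: le_trans (sinc_lipschitz g0 _ _) _.
    by rewrite subr0 ler_wpM2l -?cabsR// !mulr_ge0// ltW.
  by rewrite le_eqVlt; apply/orP; left; apply/eqP; ring.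
have mP : cmfun (fun x : R => P.[x%:C%C]).
  split; under eq_fun do rewrite PE /=.
    exact: (continuous_measurable_fun (@continuous_horner _ p1)).
  exact: (continuous_measurable_fun (@continuous_horner _ p2)).
have mm := cmfunM (cmfun_trig_poly delta (P \Po slow delta)) (cmfun_sinc g0).
have Py : (\int[mu]_(x in `[(- B)%R, B]) (cabs (P.[x%:C%C] - y x) ^+ 2)%:E < (e / 4)%:E)%E.
  have -> : (\int[mu]_(x in `[(- B)%R, B]) (cabs (P.[x%:C%C] - y x) ^+ 2)%:E =
     dist2 `[(- B)%R, B] (fun x => Re (y x)) (horner p1) +
     dist2 `[(- B)%R, B] (fun x => Im (y x)) (horner p2))%E.
    rewrite /dist2 -ge0_integralD//.
    - apply: eq_integral => x _; rewrite cabs2 PE ReD ImD ReN ImN /= -EFinD.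
      by congr EFin; ring.
    - by move=> x _; rewrite lee_fin sqr_ge0.
    - apply: measurable_dist2 => //.
      exact: (continuous_measurable_fun (@continuous_horner _ p1)).
    - by move=> x _; rewrite lee_fin sqr_ge0.
    - apply: measurable_dist2 => //.
      exact: (continuous_measurable_fun (@continuous_horner _ p2)).
  by rewrite (_ : e / 4 = e / 8 + e / 8) ?EFinD ?lteD//; field.
have close2 : (\int[mu]_(x in `[(- B)%R, B])
    (cabs (trig_poly delta (P \Po slow delta) x * sinc g x - P.[x%:C%C]) ^+ 2)%:E <= (e / 8)%:E)%E.
  apply: (@le_trans _ _ (\int[mu]_(x in `[(- B)%R, B]) (a ^+ 2)%:E)%E).
    apply: ge0_le_integral => //.
    - by move=> x _; rewrite lee_fin sqr_ge0.
    - by apply: measurable_funTS; apply: measurable_cabs2; exact: cmfunB.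
    - move=> x /=; rewrite in_itv/= => xB.
      by rewrite lee_fin ler_sqr ?nnegrE ?cabs_ge0 ?(ltW a0)// close.
  have -> : (e / 8)%:E = ((a ^+ 2)%:E * (2 * B)%:E)%E.
    by rewrite -EFinM a2; congr EFin; field; rewrite gt_eqF.
  by rewrite integral_cst// -lebesgue_measure_sym_itv// ltW.
apply: (@le_lt_trans _ _ (2%:E * (\int[mu]_(x in `[(- B)%R, B])
    (cabs (trig_poly delta (P \Po slow delta) x * sinc g x - P.[x%:C%C]) ^+ 2)%:E +
    \int[mu]_(x in `[(- B)%R, B]) (cabs (P.[x%:C%C] - y x) ^+ 2)%:E))%E).
  rewrite -ge0_integralD//; last 4 first.
  - by move=> x _; rewrite lee_fin sqr_ge0.
  - by apply: measurable_funTS; apply: measurable_cabs2; exact: cmfunB.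
  - by move=> x _; rewrite lee_fin sqr_ge0.
  - by apply: measurable_funTS; apply: measurable_cabs2; exact: cmfunB.
  rewrite -ge0_integralZl//; last 2 first.
  - by apply: emeasurable_funD; apply: measurable_funTS; apply: measurable_cabs2; exact: cmfunB.
  - by move=> x _; rewrite adde_ge0// lee_fin sqr_ge0.
  apply: ge0_le_integral => //.
  - by move=> x _; rewrite lee_fin sqr_ge0.
  - by apply: measurable_funTS; apply: measurable_cabs2; exact: cmfunB.
  - apply: measurable_funeM.
    by apply: emeasurable_funD; apply: measurable_funTS; apply: measurable_cabs2; exact: cmfunB.
  - move=> x _; rewrite -EFinD -EFinM lee_fin.
    rewrite [X in cabs X ^+ 2 <= _](_ : _ = (trig_poly delta (P \Po slow delta) x *
        sinc g x - P.[x%:C%C]) + (P.[x%:C%C] - y x)).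
      exact: cabs2D.
    by rewrite addrA subrK.
have -> : e%:E = (2%:E * ((e / 4)%:E + (e / 4)%:E))%E.
  by rewrite -EFinD -EFinM; congr EFin; field.
rewrite lte_pmul2l// lee_ltD//.
  rewrite ge0_fin_numE ?(le_lt_trans close2) ?ltry// integral_ge0// => x _.
  by rewrite lee_fin sqr_ge0.
by apply: le_trans close2 _; rewrite lee_fin; lra.
Qed.

End TrigonometricApproximation.

(** * Hilbert-Schmidt operators *)

Section Averaging.
Context {R : realType}.
Local Notation mu := (@lebesgue_measure R).
Local Notation Re := complex.Re.
Local Notation Im := complex.Im.

(** Tonelli's theorem gives measurability for the positive and negative parts; their difference in
    the extended reals stays measurable, and so does its image under [fine]. *)
Lemma measurable_Rintegral_slice (F : R * R -> R) : measurable_fun setT F ->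
  measurable_fun setT (fun x => \int[mu]_y F (x, y)).
Proof.
move=> mF; have mF' : measurable_fun setT (EFin \o F) by exact/measurable_EFinP.
have H : measurable_fun setT (fun x => (\int[mu]_y (F (x, y))%:E)%E).
  rewrite (_ : (fun x => _) = (fun x => (\int[mu]_y (EFin \o F)^\+ (x, y) -
      \int[mu]_y (EFin \o F)^\- (x, y))%E)).
    apply: emeasurable_funB.
      by apply: measurable_integral_slice => //; exact: measurable_funepos.
    by apply: measurable_integral_slice => //; exact: measurable_funeneg.
  apply/funext => x; rewrite [LHS]integralE.
  congr (_ - _)%E; apply: eq_integral => y _.
    by rewrite !(funeposE, funenegE).
  by rewrite !(funeposE, funenegE).
by rewrite /Rintegral; apply: measurableT_comp H.
Qed.

(** The convolution [box_d * f]. In this form its value at a fixed [x] is a pairing of [f] with one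
    square-integrable function, to which Cauchy-Schwarz and Bessel apply. *)
Definition avg (d : R) (f : R -> R[i]) (x : R) : R[i] :=
  cintegral (fun s => cbox d (x - s) * f s).

Lemma cmfun_avg d (f : R -> R[i]) : cmfun f -> cmfun (avg d f).
Proof.
move=> mf.
have mF : cmfun (fun p : R * R => cbox d (p.1 - p.2) * f p.2).
  apply: cmfunM; last by apply: (cmfun_comp mf).
  apply: (cmfun_comp (@cmfun_cbox R d)).
  by apply: measurable_funB.
have [m1 m2] := mF.
by split; [exact: (measurable_Rintegral_slice m1)|exact: (measurable_Rintegral_slice m2)].
Qed.

Context (d : R).
Context (d0 : 0 < d).

Lemma box_translate (x s : R) : box d (x - s) = (2 * d)^-1 * \1_`[(x - d)%R, x + d] s.
Proof.
rewrite /box !indicE; congr (_ * (nat_of_bool _)%:R).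
by apply/idP/idP; rewrite !inE /= !in_itv/= => /andP[? ?]; apply/andP; split; lra.
Qed.

Lemma cmfun_cbox_translate (x : R) : cmfun (fun s : R => cbox d (x - s)).
Proof.
by apply: (cmfun_comp (@cmfun_cbox R d)); apply: measurable_funB.
Qed.

Lemma integral_box_translate (x : R) : (\int[mu]_s (box d (x - s))%:E = 1)%E.
Proof.
under eq_integral do rewrite box_translate EFinM.
rewrite ge0_integralZl//; last by rewrite lee_fin invr_ge0 mulr_ge0// ltW.
- rewrite integral_indic//= setIT lebesgue_measure_itv/= lte_fin ifT; last by have := d0; lra.
  rewrite -EFinB -EFinM (_ : x + d - (x - d) = 2 * d); last by ring.
  by rewrite mulVf// gt_eqF// mulr_gt0.
- by apply/measurable_EFinP; apply: measurable_indic; exact: measurable_itv.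
Qed.

Lemma sq_cbox_translate (x : R) : sq (fun s => cbox d (x - s)) = ((2 * d)^-1)%:E.
Proof.
rewrite /sq.
transitivity (\int[mu]_s (((2 * d)^-1)%:E * (box d (x - s))%:E))%E.
  apply: eq_integral => s _; rewrite cabs_cbox// -EFinM expr2 {1}box_translate box_translate.
  by rewrite indicE; case: (s \in _); rewrite ?mulr1// !mulr0.
rewrite ge0_integralZl ?integral_box_translate ?mule1//.
- apply/measurable_EFinP; apply: measurableT_comp (@measurable_box R d) _.
  exact: measurable_funB.
- by move=> s _; rewrite lee_fin box_ge0.
- by rewrite lee_fin invr_ge0 mulr_ge0// ltW.
Qed.

Lemma L2_cbox_translate (x : R) : L2 (fun s => cbox d (x - s)).
Proof.
by apply/L2P; split; [exact: cmfun_cbox_translate|rewrite sq_cbox_translate ltry].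
Qed.

Lemma nrm2_cbox_translate (x : R) : nrm2 (fun s => cbox d (x - s)) = (2 * d)^-1.
Proof. by apply: EFin_inj; rewrite -sqE ?sq_cbox_translate//; exact: L2_cbox_translate. Qed.

Lemma avg_cintegrable f (x : R) : L2 f -> cintegrable (fun s => cbox d (x - s) * f s).
Proof. by move=> Lf; apply: L2M_cintegrable => //; exact: L2_cbox_translate. Qed.

Lemma inner_avg f (x : R) : L2 f -> cabs (avg d f x) = cabs (inner (fun s => cbox d (x - s)) f).
Proof.
move=> Lf; rewrite -[RHS]cabsJ /inner -cintegralJ; last first.
  by apply: inner_cintegrable => //; exact: L2_cbox_translate.
congr cabs; apply: eq_cintegral => s; rewrite rmorphM/= conjcK; congr (_ * _).
by apply: complex_ext => //=; rewrite oppr0.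
Qed.

Lemma avg_le f (x : R) : L2 f -> cabs (avg d f x) ^+ 2 <= (2 * d)^-1 * nrm2 f.
Proof.
move=> Lf; rewrite inner_avg// -(nrm2_cbox_translate x).
by apply: cauchy_schwarz => //; exact: L2_cbox_translate.
Qed.

(** Up to conjugation the averages are the coefficients of [box_d(x - .)], whose squared norm
    [1 / (2 d)] does not depend on [x]. *)
Lemma avg_bessel (e : nat -> R -> R[i]) n (x : R) : (forall k, L2 (e k)) ->
  (forall j k, inner (e j) (e k) = (j == k)%:R) ->
  \sum_(k < n) cabs (avg d (e k) x) ^+ 2 <= (2 * d)^-1.
Proof.
move=> Le oe; rewrite -(nrm2_cbox_translate x).
rewrite (eq_bigr (fun k : 'I_n => cabs (inner (fun s => cbox d (x - s)) (e k)) ^+ 2)).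
  by apply: bessel => //; exact: L2_cbox_translate.
by move=> k _; rewrite inner_avg.
Qed.

Lemma avg_linear (a : R[i]) f g (x : R) : L2 f -> L2 g ->
  avg d (fun s => a * f s + g s) x = a * avg d f x + avg d g x.
Proof.
move=> Lf Lg; rewrite /avg -cintegralZ; last exact: avg_cintegrable.
rewrite -cintegralD; [|exact/cintegrableZ/avg_cintegrable|exact: avg_cintegrable].
by apply: eq_cintegral => s; rewrite mulrDr mulrCA.
Qed.

Lemma cmfun_chi (A : set R) : measurable A -> cmfun (chi A).
Proof. by move=> mA; apply: cmfunR; exact: measurable_indic. Qed.

Lemma chi_in (A : set R) x : A x -> chi A x = 1.
Proof. by move=> Ax; rewrite /chi indicE mem_set. Qed.

Lemma chi_out (A : set R) x : ~ A x -> chi A x = 0.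
Proof. by move=> Ax; rewrite /chi indicE memNset. Qed.

Lemma cabs_chi_le (A : set R) x : cabs (chi A x) <= 1.
Proof. by rewrite /chi cabsR ger0_norm// indic_le1. Qed.

Lemma L2_chi (B : R) : L2 (chi `[(- B)%R, B]).
Proof.
apply/L2P; split; first by apply: cmfun_chi; exact: measurable_itv.
rewrite /sq (_ : (fun x => _) = (fun x => (\1_`[(- B)%R, B] x)%:E)).
  rewrite integral_indic//= setIT lebesgue_measure_itv/=.
  by case: ifP => _; rewrite ?ltry// -EFinB ltry.
apply/funext => x; rewrite /chi cabsR indicE; case: (x \in _); last by rewrite normr0 expr0n.
by rewrite normr1 expr1n.
Qed.

Lemma integrable_box_translate (x : R) : mu.-integrable setT (EFin \o (fun s => box d (x - s))).
Proof.
apply/integrableP; split.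
  apply/measurable_EFinP; apply: measurableT_comp (@measurable_box R d) _.
  exact: measurable_funB.
under eq_integral do rewrite /= ger0_norm ?box_ge0//.
by rewrite integral_box_translate ltry.
Qed.

Lemma cintegral_cbox_translate (x : R) : cintegral (fun s => cbox d (x - s)) = 1.
Proof.
apply: complex_ext => /=; first by rewrite /Rintegral integral_box_translate.
by rewrite /Rintegral integral0.
Qed.

Lemma avg_chi_in (B x : R) : - B + d <= x <= B - d -> avg d (chi `[(- B)%R, B]) x = 1.
Proof.
move=> /andP[x1 x2]; rewrite -(cintegral_cbox_translate x); apply: eq_cintegral => s.
have [sx|sx] := boolP (- d <= x - s <= d).
  rewrite chi_in ?mulr1//= in_itv/=; move/andP: sx => [? ?]; apply/andP; split; lra.
by rewrite /cbox box_out ?mul0r//; exact/negP.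
Qed.

Lemma avg_chi_out (B x : R) : x < - B - d \/ B + d < x -> avg d (chi `[(- B)%R, B]) x = 0.
Proof.
move=> xB; rewrite -(@cintegral0 R); apply: eq_cintegral => s.
have [sx|sx] := boolP (- d <= x - s <= d).
  rewrite chi_out ?mulr0//= in_itv/= => /andP[? ?].
  by move/andP: sx => [? ?]; case: xB => ?; lra.
by rewrite /cbox box_out ?mul0r//; exact/negP.
Qed.

Lemma cabs_avg_chi (B x : R) : cabs (avg d (chi `[(- B)%R, B]) x) <= 2.
Proof.
have -> : 2 = 2 * \int[mu]_s box d (x - s).
  by rewrite /Rintegral integral_box_translate mulr1.
apply: cabs_cintegral_le; first last.
- by move=> s; rewrite cabsM cabs_cbox// ler_piMr ?box_ge0// cabs_chi_le.
- exact: integrable_box_translate.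
- by apply: cmfunM; [exact: cmfun_cbox_translate|apply: cmfun_chi; exact: measurable_itv].
Qed.

(** The points within [d] of an endpoint of [[-B, B]], where averaging can change [chi]. *)
Definition edge (B : R) : set R :=
  `[(- B - d)%R, (- B + d)%R] `|` `[(B - d)%R, (B + d)%R].

Lemma measurable_edge B : measurable (edge B).
Proof. by apply: measurableU; exact: measurable_itv. Qed.

Lemma lebesgue_measure_edge B : (mu (edge B) <= (4 * d)%:E)%E.
Proof.
have E a : mu `[(a - d)%R, (a + d)%R] = (2 * d)%:E.
  have d0' := d0; rewrite lebesgue_measure_itv/= lte_fin ifT; last lra.
  by rewrite -EFinB; congr EFin; ring.
apply: (@le_trans _ _ (mu `[(- B - d)%R, (- B + d)%R] + mu `[(B - d)%R, (B + d)%R])%E).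
  by apply: measureU2; exact: measurable_itv.
by rewrite !E -EFinD lee_fin; lra.
Qed.

Lemma avg_chi_sub (B x : R) :
  cabs (avg d (chi `[(- B)%R, B]) x - chi `[(- B)%R, B] x) <= 3 * \1_(edge B) x.
Proof.
have [xe|xe] := pselect (edge B x).
  rewrite indicE mem_set// mulr1; apply: le_trans (cabsD _ _) _.
  by rewrite cabsN (_ : 3 = 2 + 1) ?lerD ?cabs_avg_chi ?cabs_chi_le//; ring.
rewrite indicE memNset// mulr0.
have [x1|x1] := boolP ((x < - B - d) || (B + d < x)).
  rewrite avg_chi_out; last exact/orP.
  rewrite chi_out ?subr0 ?cabs0//= in_itv/= => /andP[? ?].
  by have d0' := d0; case/orP: x1; lra.
move: x1; rewrite negb_or -!leNgt => /andP[x1 x2].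
have x3 : - B + d < x.
  rewrite ltNge; apply/negP => h; apply: xe; left; rewrite /= in_itv/=.
  by rewrite x1 h.
have x4 : x < B - d.
  rewrite ltNge; apply/negP => h; apply: xe; right; rewrite /= in_itv/=.
  by rewrite x2 h.
rewrite avg_chi_in; last by rewrite !ltW.
have d0' := d0; rewrite chi_in ?subrr ?cabs0//= in_itv/=; apply/andP; split; lra.
Qed.

End Averaging.

Section MultipliedAverage.
Context {R : realType}.
Local Notation mu := (@lebesgue_measure R).
Context (m : R -> R[i]) (d : R).
Context (Lm : L2 m) (d0 : 0 < d).

Definition opH (f : R -> R[i]) (x : R) : R[i] := m x * avg d f x.

Lemma cmfun_opH f : L2 f -> cmfun (opH f).
Proof. by move=> Lf; apply: cmfunM; [exact: L2_cmfun|apply: cmfun_avg; exact: L2_cmfun]. Qed.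

Lemma sq_opH f : L2 f -> (sq (opH f) <= ((2 * d)^-1 * nrm2 m)%:E * sq f)%E.
Proof.
move=> Lf; have K0 : 0 <= (2 * d)^-1 * nrm2 f.
  by rewrite mulr_ge0 ?nrm2_ge0// invr_ge0 mulr_ge0// ltW.
apply: (@le_trans _ _ (((2 * d)^-1 * nrm2 f)%:E * sq m)%E); last first.
  by rewrite (sqE Lf) (sqE Lm) -!EFinM lee_fin mulrAC.
rewrite /sq -ge0_integralZl//; last 2 first.
- by apply: measurable_cabs2; exact: L2_cmfun.
- by move=> x _; rewrite lee_fin sqr_ge0.
apply: ge0_le_integral => //.
- by move=> x _; rewrite lee_fin sqr_ge0.
- by apply: measurable_cabs2; exact: cmfun_opH.
- by apply: measurable_funeM; apply: measurable_cabs2; exact: L2_cmfun.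
- move=> x _; rewrite -EFinM lee_fin cabsM exprMn mulrC.
  by rewrite ler_wpM2r ?sqr_ge0// avg_le.
Qed.

Lemma L2_opH f : L2 f -> L2 (opH f).
Proof.
move=> Lf; apply/L2P; split; first exact: cmfun_opH.
by apply: le_lt_trans (sq_opH Lf) _; rewrite (sqE Lf) -EFinM ltry.
Qed.

Lemma bounded_linear_opH : bounded_linear opH.
Proof.
have K0 : 0 <= (2 * d)^-1 * nrm2 m.
  by rewrite mulr_ge0 ?nrm2_ge0// invr_ge0 mulr_ge0// ltW.
split.
- exact: L2_opH.
- move=> a f g Lf Lg; apply: aeW => x; rewrite /opH avg_linear//.
  by rewrite mulrDr mulrCA.
- exists (Num.sqrt ((2 * d)^-1 * nrm2 m)) => f Lf; apply: L2norm_leM.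
  + exact: sqrtr_ge0.
  + by rewrite (sqE Lf) ltry.
  + by rewrite sqr_sqrtr// sq_opH.
Qed.

(** Multiplying the pointwise Bessel bound by [|m(x)|^2] and integrating bounds all partial sums by
    [nrm2 m / (2 d)]. *)
Lemma hilbert_schmidt_opH : hilbert_schmidt opH.
Proof.
split; first exact: bounded_linear_opH.
move=> e [Le oe _].
have K0 : 0 <= (2 * d)^-1 by rewrite invr_ge0 mulr_ge0// ltW.
have bnd n : (\sum_(0 <= k < n) L2norm (opH (e k)) ^+ 2 <= ((2 * d)^-1 * nrm2 m)%:E)%E.
  rewrite big_mkord; under eq_bigr do rewrite L2norm_sq.
  rewrite /sq -ge0_integral_sum//; last 2 first.
  - by move=> k; apply: measurable_cabs2; apply: cmfun_opH.
  - by move=> k x _; rewrite lee_fin sqr_ge0.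
  rewrite EFinM -(sqE Lm) /sq -ge0_integralZl//; last 2 first.
  - by apply: measurable_cabs2; exact: L2_cmfun.
  - by move=> x _; rewrite lee_fin sqr_ge0.
  apply: ge0_le_integral => //.
  - by move=> x _; apply: sume_ge0 => k _; rewrite lee_fin sqr_ge0.
  - by apply: emeasurable_sum => k; apply: measurable_cabs2; exact: cmfun_opH.
  - by apply: measurable_funeM; apply: measurable_cabs2; exact: L2_cmfun.
  - move=> x _; rewrite sumEFin -EFinM lee_fin.
    under eq_bigr do rewrite cabsM exprMn.
    by rewrite -mulr_sumr mulrC ler_wpM2r ?sqr_ge0// avg_bessel.
apply: le_lt_trans (ltry ((2 * d)^-1 * nrm2 m)).
apply: lime_le; last exact: nearW.
by apply: is_cvg_nneseries => n _ _; rewrite L2norm_sq sq_ge0.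
Qed.

(** The difference lives on [edge], where it is at most [3 M]; as the measure of [edge] is at most
    [4 d], the constant is [36 = 9 * 4]. *)
Lemma opH_chi_sub (B M : R) : (forall x, cabs (m x) <= M) ->
  (sq (fun x => opH (chi `[(- B)%R, B]) x - m x * chi `[(- B)%R, B] x)%R <=
   (36 * M ^+ 2 * d)%:E)%E.
Proof.
move=> mM; have M0 : 0 <= M := le_trans (cabs_ge0 _) (mM 0).
have mchi : cmfun (chi `[(- B)%R, B]) by apply: cmfun_chi; exact: measurable_itv.
apply: (@le_trans _ _ (\int[mu]_x ((9 * M ^+ 2)%:E * (\1_(edge d B) x)%:E))%E).
  apply: ge0_le_integral => //.
  - by move=> x _; rewrite lee_fin sqr_ge0.
  - apply: measurable_cabs2; apply: cmfunB.
      by apply: cmfun_opH; exact: L2_chi.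
    by apply: cmfunM => //; exact: L2_cmfun.
  - apply: measurable_funeM; apply/measurable_EFinP; apply: measurable_indic.
    exact: measurable_edge.
  - move=> x _; rewrite -EFinM lee_fin /opH -mulrBr cabsM.
    have -> : 9 * M ^+ 2 * \1_(edge d B) x = (M * (3 * \1_(edge d B) x)) ^+ 2.
      by rewrite indicE; case: (_ \in _) => /=; ring.
    rewrite ler_sqr ?nnegrE ?mulr_ge0 ?cabs_ge0//.
    by apply: ler_pM; rewrite ?cabs_ge0// avg_chi_sub.
rewrite ge0_integralZl//; last 2 first.
- by apply/measurable_EFinP; apply: measurable_indic; exact: measurable_edge.
- by rewrite lee_fin mulr_ge0// sqr_ge0.
rewrite integral_indic//= ?setIT; last exact: measurable_edge.
have -> : (36 * M ^+ 2 * d)%:E = ((9 * M ^+ 2)%:E * (4 * d)%:E)%E.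
  by rewrite -EFinM; congr EFin; ring.
by rewrite lee_wpmul2l ?lebesgue_measure_edge// lee_fin mulr_ge0// sqr_ge0.
Qed.

End MultipliedAverage.

(** * Spreading functions *)

Section Reflection.
Context {R : realType}.
Local Notation mu := (@lebesgue_measure R).

Lemma measurable_reflect (x : R) :
  measurable_fun setT ((fun s => x - s) : measurableTypeR R -> measurableTypeR R).
Proof. exact: measurable_funB. Qed.

(** Uniqueness of Lebesgue measure: it suffices to compare half-open intervals. Reflection moves the
    closed end to the other side, which leaves the length unchanged. *)
Lemma lebesgue_measure_reflect (x : R) (A : set R) : measurable A ->
  pushforward mu ((fun s => x - s) : _ -> measurableTypeR R) A = mu A.
Proof.
(* Bundled as a measurable function, so that the pushforward is recognised as a measure. *)
pose phi : {mfun measurableTypeR R >-> measurableTypeR R} :=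
  HB.pack ((fun s => x - s) : measurableTypeR R -> measurableTypeR R)
    (isMeasurableFun.Build _ _ _ _ _ (measurable_reflect x)).
rewrite -[(fun s => _) : _ -> measurableTypeR R]/(phi : _ -> _).
move=> mA; apply/esym/lebesgue_measure_unique => //= _ [[a b]] _ <-.
rewrite /pushforward.
have -> : (fun s : R => x - s) @^-1` [set` `]a, b]] = `[x - b, x - a[%classic.
  by apply/seteqP; split => s /=; rewrite !in_itv/= => /andP[? ?]; apply/andP; split; lra.
rewrite !lebesgue_measure_itv/= !lte_fin ltrD2l ltrN2.
by case: ifP => // _; rewrite -!EFinB; congr EFin; ring.
Qed.

Lemma ge0_integral_reflect (x : R) (f : R -> \bar R) : measurable_fun setT f ->
  (forall s, 0 <= f s)%E -> (\int[mu]_s f s = \int[mu]_s f (x - s)%R)%E.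
Proof.
move=> mf f0.
have mphi := measurable_reflect x.
have := @ge0_integral_pushforward _ _ _ _ R _ mphi mu setT f measurableT mf (fun s _ => f0 s).
rewrite preimage_setT => <-.
by apply: eq_measure_integral => //= A mA _; exact/esym/lebesgue_measure_reflect.
Qed.

Lemma Rintegral_reflect (x : R) (f : R -> R) : measurable_fun setT f ->
  \int[mu]_s f s = \int[mu]_s f (x - s).
Proof.
move=> mf; have mf' : measurable_fun setT (EFin \o f) by exact/measurable_EFinP.
rewrite /Rintegral; congr fine; rewrite [LHS]integralE [RHS]integralE.
congr (_ - _)%E.
  rewrite (@ge0_integral_reflect x); last 2 first.
  - exact: measurable_funepos.
  - exact: funepos_ge0.
  by apply: eq_integral => s _; rewrite !funeposE.
rewrite (@ge0_integral_reflect x); last 2 first.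
- exact: measurable_funeneg.
- exact: funeneg_ge0.
by apply: eq_integral => s _; rewrite !funenegE.
Qed.

Lemma cintegral_reflect (x : R) (f : R -> R[i]) : cmfun f ->
  cintegral f = cintegral (fun s => f (x - s)).
Proof.
by move=> [f1 f2]; apply: complex_ext => /=; exact: Rintegral_reflect.
Qed.

Lemma avgE (d : R) (f : R -> R[i]) (x : R) : cmfun f ->
  avg d f x = cintegral (fun t => cbox d t * f (x - t)).
Proof.
move=> mf; rewrite /avg (@cintegral_reflect x).
  by apply: eq_cintegral => s; rewrite subKr.
apply: cmfunM => //; apply: (cmfun_comp (@cmfun_cbox R d)).
exact: measurable_funB.
Qed.

End Reflection.

Section Fubini.
Context {R : realType}.
Local Notation mu := (@lebesgue_measure R).

(** The integrand is dominated by the product [|k(t)| H(x)], which is integrable on the plane. *)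
Lemma cintegral_swap (k : R -> R[i]) (G : R * R -> R[i]) (H : R -> R) :
  cintegrable k -> cmfun G -> mu.-integrable setT (EFin \o H) ->
  (forall t x, cabs (G (t, x)) <= H x) ->
  cintegral (fun t => k t * cintegral (fun x => G (t, x))) =
  cintegral (fun x => cintegral (fun t => k t * G (t, x))).
Proof.
move=> ik mG iH GH.
have mk := cintegrable_cmfun ik.
have mG1 t : cmfun (fun x => G (t, x)).
  by apply: (cmfun_comp mG); exact: pair1_measurable.
have mG2 x : cmfun (fun t => G (t, x)).
  by apply: (cmfun_comp mG); exact: pair2_measurable.
have iG t : cintegrable (fun x => G (t, x)) by exact: cintegrable_le (GH t).
have mF : cmfun (fun p : R * R => k p.1 * G p).
  by apply: cmfunM => //; apply: (cmfun_comp mk).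
rewrite -(@cintegral_Fubini R (fun p => k p.1 * G p)) => //=.
- by apply: eq_cintegral => t; rewrite cintegralZ.
- have [mH Hoo] := integrableP _ _ _ iH.
  have H0 x : 0 <= H x := le_trans (cabs_ge0 _) (GH 0 x).
  have koo : (\int[mu]_t (cabs (k t))%:E < +oo)%E.
    exact: (integrable_lty measurableT (integrable_cabs ik)).
  apply: (@le_lt_trans _ _ (\int[mu]_t ((cabs (k t))%:E * \int[mu]_x (H x)%:E))%E).
    apply: ge0_le_integral => //.
    + by move=> t _; apply: integral_ge0 => x _; rewrite lee_fin cabs_ge0.
    + apply: (measurable_integral_slice (F := fun p => (cabs (k p.1 * G p))%:E)).
        exact/measurable_EFinP/measurable_cabs.
      by move=> p; rewrite lee_fin cabs_ge0.
    + apply: emeasurable_funM; last exact: measurable_cst.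
      exact/measurable_EFinP/measurable_cabs.
    + move=> t _; rewrite -ge0_integralZl//; last 2 first.
        by move=> x _; rewrite lee_fin.
        by rewrite lee_fin cabs_ge0.
      apply: ge0_le_integral => //.
      * by move=> x _; rewrite lee_fin cabs_ge0.
      * apply/measurable_EFinP/measurable_cabs.
        exact: (cmfunM (cmfun_cst (k t)) (mG1 t)).
      * exact: measurable_funeM.
      * by move=> x _; rewrite -EFinM lee_fin cabsM ler_wpM2l ?cabs_ge0.
  have -> : (\int[mu]_x (H x)%:E = (\int[mu]_x H x)%:E)%E.
    by rewrite /Rintegral fineK//; exact: integrable_fin_num.
  rewrite ge0_integralZr//.
  + rewrite muleC lte_mul_pinfty// lee_fin.
    by apply: Rintegral_ge0 => x _.
  + exact/measurable_EFinP/measurable_cabs.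
  + by move=> t _; rewrite lee_fin cabs_ge0.
  + by rewrite lee_fin; apply: Rintegral_ge0 => x _.
- by move=> t; exact: cintegrableZ.
- move=> x; under eq_fun do rewrite mulrC.
  exact: (cintegrableM_bounded ik (mG2 x) (fun t => GH t x)).
Qed.

End Fubini.

Section SchwartzFunctions.
Context {R : realType}.
Local Notation Re := complex.Re.
Local Notation Im := complex.Im.
Local Notation mu := (@lebesgue_measure R).

Lemma derivable_lipschitz (h : R -> R) (K : R) : (forall x, derivable h x 1) ->
  (forall x, `|derive1 h x| <= K) -> forall x y, `|h x - h y| <= K * `|x - y|.
Proof.
move=> dh hK x y; wlog xy : x y / y <= x.
  move=> W; have [/W//|/ltW/W] := leP y x.
  by rewrite distrC [`|x - y|]distrC.
have dh' (z : R) : is_derive z (1 : R) h (derive1 h z).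
  by rewrite derive1E; exact: derivableP.
have ch : continuous h.
  by move=> z; apply: differentiable_continuous; apply/derivable1_diffP.
have [c _ ->] := MVT_segment xy (fun z _ => dh' z) (continuous_subspaceT ch).
by rewrite normrM ler_wpM2r.
Qed.

Lemma cderivable_lipschitz (f : R -> R[i]) (K : R) : (forall x, cderivable f x) ->
  (forall x, cabs (cderive f x) <= K) ->
  forall x y, cabs (f x - f y) <= 2 * K * `|x - y|.
Proof.
move=> df fK x y; apply: le_trans (cabs_le _) _.
rewrite ReD ImD ReN ImN -mulrA mulrDl mul1r lerD//.
  apply: (@derivable_lipschitz (fun x => Re (f x))) => z; first by case: (df z).
  by apply: le_trans (fK z); exact: (cabs_Re (cderive f z)).
apply: (@derivable_lipschitz (fun x => Im (f x))) => z; first by case: (df z).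
by apply: le_trans (fK z); exact: (cabs_Im (cderive f z)).
Qed.

Lemma cderivable_cmfun (f : R -> R[i]) : (forall x, cderivable f x) -> cmfun f.
Proof.
move=> df.
by split; apply: continuous_measurable_fun => x; apply: differentiable_continuous;
  apply/derivable1_diffP; case: (df x).
Qed.

Lemma schwartz1_cmfun (f : R -> R[i]) : schwartz1 f -> cmfun f.
Proof. by move=> /(_ 0%N)[df _]; exact: cderivable_cmfun. Qed.

Lemma schwartz1_bounded (f : R -> R[i]) : schwartz1 f ->
  exists K, forall x, cabs (f x) <= K.
Proof.
move=> /(_ 0%N)[_ /(_ 0%N)[K HK]]; exists K => x.
by have := HK x; rewrite /= expr0 mul1r.
Qed.

Lemma integrable_oneDsqr : mu.-integrable setT (EFin \o (fun x : R => (oneDsqr x)^-1)).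
Proof.
apply/integrableP; split.
  by apply/measurable_EFinP; exact: (continuous_measurable_fun (@continuous_oneDsqrV R)).
under eq_integral.
  move=> x _; rewrite /= ger0_norm; last by rewrite invr_ge0 addr_ge0 ?sqr_ge0.
  over.
exact: integral_oneDsqr_lty.
Qed.

Lemma schwartz1_cintegrable (f : R -> R[i]) : schwartz1 f -> cintegrable f.
Proof.
move=> sf; have [K HK] := schwartz1_bounded sf.
have [_ /(_ 2%N)[L HL]] := sf 0%N.
apply: (@cintegrable_le _ _ (fun x => (K + L) * (oneDsqr x)^-1)).
- exact: schwartz1_cmfun.
- exact: (integrableZl measurableT (K + L) integrable_oneDsqr).
- move=> x; rewrite ler_pdivlMr ?oneDsqr_gt0// /oneDsqr mulrDr mulr1 lerD//.
  by have := HL x; rewrite /= real_normK ?num_real// mulrC.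
Qed.

Implicit Types Phi Psi : R * R -> R[i].

Lemma schwartz2_bounded Phi : schwartz2 Phi -> exists K, forall p, cabs (Phi p) <= K.
Proof.
move=> [_ /(_ 0%N 0%N [::])[K HK]]; exists K => p.
by have := HK p; rewrite /weighted /= !expr0 !mul1r.
Qed.

Lemma schwartz2_lipschitz Phi (k : bool) : schwartz2 Phi ->
  exists K, forall p u v, cabs (slice k Phi p u - slice k Phi p v) <= K * `|u - v|.
Proof.
move=> [dPhi /(_ 0%N 0%N [:: k])[K HK]]; exists (2 * K) => p.
(* Moving the base point along its own line leaves the slice unchanged, so the derivative of this
   slice at [u] is a partial derivative of [Phi] at the moved point. *)
have E u : slice k Phi (if k then (p.1, u) else (u, p.2)) = slice k Phi p.
  by apply/funext => v; rewrite /slice; case: (k).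
have E' (u : R) : Defs.coord k (if k then (p.1, u) else (u, p.2)) = u.
  by rewrite /Defs.coord; case: (k).
apply: cderivable_lipschitz => u.
  have := dPhi [::] k (if k then (p.1, u) else (u, p.2)).
  by rewrite /pderivable /= E E'.
have := HK (if k then (p.1, u) else (u, p.2)).
by rewrite /weighted /= !expr0 !mul1r /pderive E E'.
Qed.

Lemma cabs_le_schwartz_norm Phi p : schwartz2 Phi -> cabs (Phi p) <= schwartz_norm 0 Phi.
Proof.
move=> sPhi; have [K HK] := schwartz2_bounded sPhi.
apply: sup_upper_bound; last first.
  exists 0%N, 0%N, [::], p; split => //.
  by rewrite /weighted /= !expr0 !mul1r.
split; first by exists (weighted 0 0 [::] Phi p), 0%N, 0%N, [::], p.
exists K => _ [a [b [w [q [a0 b0 w0 ->]]]]].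
move: a0 b0 w0; rewrite !leqn0 size_eq0 => /eqP -> /eqP -> /eqP ->.
by rewrite /weighted /= !expr0 !mul1r.
Qed.

End SchwartzFunctions.

Section BoxDistribution.
Context {R : realType}.
Context (d g w : R).
Context (d0 : 0 < d) (g0 : 0 < g).
Implicit Types Phi Psi : R * R -> R[i].

Definition box_inner Phi (t : R) : R[i] :=
  cintegral (fun nu => cbox g nu * Phi (t, nu + w)).

(** The distribution with density [box_d(t) box_g(nu - w)], as an iterated integral. *)
Definition box_dist Phi : R[i] := cintegral (fun t => cbox d t * box_inner Phi t).

Lemma cmfun_schwartz2_slice Phi (t : R) : schwartz2 Phi -> cmfun (fun nu : R => Phi (t, nu + w)).
Proof.
move=> sPhi; have [K HK] := schwartz2_lipschitz true sPhi.
apply: (@lipschitz_cmfun _ _ K) => u v.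
by have := HK (t, 0) (u + w) (v + w); rewrite /slice /= opprD addrACA subrr addr0.
Qed.

Lemma box_inner_cintegrable Phi (t : R) : schwartz2 Phi ->
  cintegrable (fun nu => cbox g nu * Phi (t, nu + w)).
Proof.
move=> sPhi; have [K HK] := schwartz2_bounded sPhi.
by apply: (@cintegrable_cboxM _ _ g0 _ K) => [|nu _]; [exact: cmfun_schwartz2_slice|].
Qed.

Lemma cabs_box_inner Phi (t K : R) : schwartz2 Phi -> (forall p, cabs (Phi p) <= K) ->
  cabs (box_inner Phi t) <= 2 * K.
Proof.
by move=> sPhi HK; apply: cabs_cintegral_cboxM => //; exact: cmfun_schwartz2_slice.
Qed.

Lemma cmfun_box_inner Phi : schwartz2 Phi -> cmfun (box_inner Phi).
Proof.
move=> sPhi; have [K HK] := schwartz2_lipschitz false sPhi.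
apply: (@lipschitz_cmfun _ _ (2 * K)) => u v.
have -> : box_inner Phi u - box_inner Phi v =
    cintegral (fun nu => cbox g nu * (Phi (u, nu + w) - Phi (v, nu + w))).
  rewrite /box_inner -[- cintegral _]mulN1r -cintegralZ; last exact: box_inner_cintegrable.
  rewrite -cintegralD; last 2 first.
  - exact: box_inner_cintegrable.
  - exact/cintegrableZ/box_inner_cintegrable.
  by apply: eq_cintegral => nu; rewrite mulN1r mulrBr.
rewrite -mulrA; apply: cabs_cintegral_cboxM => // [|nu _].
  by apply: cmfunB; exact: cmfun_schwartz2_slice.
exact: (HK (0, nu + w)).
Qed.

Lemma box_dist_cintegrable Phi : schwartz2 Phi ->
  cintegrable (fun t => cbox d t * box_inner Phi t).
Proof.
move=> sPhi; have [K HK] := schwartz2_bounded sPhi.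
apply: (@cintegrable_cboxM _ _ d0 _ (2 * K)) => [|t _]; first exact: cmfun_box_inner.
exact: cabs_box_inner.
Qed.

Lemma box_dist_linear (a : R[i]) Phi Psi : schwartz2 Phi -> schwartz2 Psi ->
  box_dist (fun p => a * Phi p + Psi p) = a * box_dist Phi + box_dist Psi.
Proof.
move=> sPhi sPsi; rewrite /box_dist -cintegralZ; last exact: box_dist_cintegrable.
rewrite -cintegralD; [|exact/cintegrableZ/box_dist_cintegrable|exact: box_dist_cintegrable].
apply: eq_cintegral => t.
have -> : box_inner (fun p => a * Phi p + Psi p) t = a * box_inner Phi t + box_inner Psi t.
  rewrite /box_inner -cintegralZ; last exact: box_inner_cintegrable.
  rewrite -cintegralD; [|exact/cintegrableZ/box_inner_cintegrable|exact: box_inner_cintegrable].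
  by apply: eq_cintegral => nu; rewrite mulrDr mulrCA.
by rewrite mulrDr mulrCA.
Qed.

Lemma cabs_box_dist Phi : schwartz2 Phi -> cabs (box_dist Phi) <= 4 * schwartz_norm 0 Phi.
Proof.
move=> sPhi; have -> : 4 * schwartz_norm 0 Phi = 2 * (2 * schwartz_norm 0 Phi) by ring.
apply: cabs_cintegral_cboxM => // [|t _]; first exact: cmfun_box_inner.
by apply: cabs_box_inner => // p; exact: cabs_le_schwartz_norm.
Qed.

Lemma box_dist_eq0 Phi :
  (forall t nu, - d <= t <= d -> - g <= nu <= g -> Phi (t, nu + w) = 0) ->
  box_dist Phi = 0.
Proof.
move=> Phi0; rewrite /box_dist -(@cintegral0 R); apply: eq_cintegral => t.
have [td|td] := boolP (- d <= t <= d); last first.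
  by rewrite /cbox box_out ?mul0r//; exact/negP.
rewrite (_ : box_inner Phi t = 0) ?mulr0// /box_inner -(@cintegral0 R).
apply: eq_cintegral => nu.
have [ng|ng] := boolP (- g <= nu <= g); first by rewrite Phi0// mulr0.
by rewrite /cbox box_out ?mul0r//; exact/negP.
Qed.

(** Two interchanges of integrals: integrating first in [nu] turns the exponential into
    [e(x w) sinc(x)], and then in [t] turns the translates of [f] into [avg d f]. *)
Lemma box_dist_tf_product (f h : R -> R[i]) : schwartz1 f -> schwartz1 h ->
  box_dist (tf_product f h) =
  cintegral (fun x => expi2pi (x * w) * sinc g x * avg d f x * conjc (h x)).
Proof.
move=> sf sh; have [K HK] := schwartz1_bounded sf.
have mf := schwartz1_cmfun sf; have mh := schwartz1_cmfun sh.
have ih := schwartz1_cintegrable sh.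
have K0 : 0 <= K := le_trans (cabs_ge0 _) (HK 0).
have iH := integrableZl measurableT K (integrable_cabs ih).
have iH2 := integrableZl measurableT (2 * K) (integrable_cabs ih).
have mfst : measurable_fun setT (fst : R * R -> R) by exact: measurable_fst.
have msnd : measurable_fun setT (snd : R * R -> R) by exact: measurable_snd.
have mfsub : cmfun (fun p : R * R => f (p.2 - p.1)).
  by apply: (cmfun_comp mf); exact: measurable_funB.
have mhJ : cmfun (fun p : R * R => conjc (h p.2)).
  by apply: cmfunJ; exact: (cmfun_comp mh).
have inner_sinc t : box_inner (tf_product f h) t =
    cintegral (fun x => expi2pi (x * w) * sinc g x * f (x - t) * conjc (h x)).
  pose G (p : R * R) := expi2pi (p.2 * (p.1 + w)) * f (p.2 - t) * conjc (h p.2).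
  have mG : cmfun G.
    apply: cmfunM => //; apply: cmfunM.
      apply: (cmfun_comp (@cmfun_expi2pi R)).
      by apply: measurable_funM => //; exact: measurable_funD.
    by apply: (cmfun_comp mf); exact: measurable_funB.
  have := cintegral_swap (cintegrable_cbox g0) mG iH.
  rewrite /box_inner /tf_product /= => ->; last first.
    by move=> nu x; rewrite !cabsM cabs_expi2pi mul1r cabsJ ler_wpM2r ?cabs_ge0.
  apply: eq_cintegral => x; rewrite /G /=.
  transitivity (cintegral (fun nu => (expi2pi (x * w) * f (x - t) * conjc (h x)) *
      (cbox g nu * expi2pi (x * nu)))).
    by apply: eq_cintegral => nu; rewrite mulrDr expi2piD; ring.
  rewrite cintegralZ; last exact: sinc_cintegrable.
  by rewrite -/(sinc g x); ring.
pose G (p : R * R) := expi2pi (p.2 * w) * sinc g p.2 * f (p.2 - p.1) * conjc (h p.2).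
have mG : cmfun G.
  apply: cmfunM => //; apply: cmfunM => //; apply: cmfunM.
    by apply: (cmfun_comp (@cmfun_expi2pi R)); exact: measurable_funM.
  exact: (cmfun_comp (cmfun_sinc g0)).
have := cintegral_swap (cintegrable_cbox d0) mG iH2.
rewrite /box_dist; under [in X in _ -> X = _]eq_cintegral do rewrite inner_sinc.
rewrite /= => ->; last first.
  move=> t x; rewrite !cabsM cabs_expi2pi mul1r cabsJ ler_wpM2r ?cabs_ge0//.
  by apply: ler_pM; rewrite ?cabs_ge0// cabs_sinc.
apply: eq_cintegral => x; rewrite /G /= avgE//.
transitivity (cintegral (fun t => (expi2pi (x * w) * sinc g x * conjc (h x)) *
    (cbox d t * f (x - t)))).
  by apply: eq_cintegral => t; ring.
rewrite cintegralZ; first by ring.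
apply: (@cintegrable_cboxM _ _ d0 _ K) => [|t _]; last exact: HK.
by apply: (cmfun_comp mf); exact: measurable_funB.
Qed.

End BoxDistribution.

Section SpreadingFunction.
Context {R : realType}.
Local Notation mu := (@lebesgue_measure R).
Context (d g delta : R) (Q : {poly R[i]}).
Context (d0 : 0 < d) (g0 : 0 < g).

Definition mult (x : R) : R[i] := trig_poly delta Q x * sinc g x.

(* The spreading function is [box d t * \sum_k Q`_k box g (nu - k delta)]; the translation
   in [nu] is moved to the test function. *)
Definition spread (Phi : R * R -> R[i]) : R[i] :=
  \sum_(k < size Q) Q`_k * box_dist d g (k%:R * delta) Phi.

Lemma mult_bounded : exists2 M, 0 <= M & forall x, cabs (mult x) <= M.
Proof.
have [M M0 HM] := trig_poly_bounded delta Q.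
exists (M * 2); first by rewrite mulr_ge0.
by move=> x; rewrite cabsM ler_pM ?cabs_ge0// cabs_sinc.
Qed.

Lemma cmfun_mult : cmfun mult.
Proof. by apply: cmfunM; [exact: cmfun_trig_poly|exact: cmfun_sinc]. Qed.

Lemma L2_mult : L2 mult.
Proof.
have [M M0 HM] := trig_poly_bounded delta Q.
apply: (L2_le cmfun_mult (L2Z M%:C%C (L2_sinc g0))) => x.
by rewrite !cabsM cabsR (ger0_norm M0) ler_wpM2r ?cabs_ge0.
Qed.

Lemma tempered_spread : tempered_distribution spread.
Proof.
split=> [a Phi Psi sPhi sPsi|].
  rewrite /spread mulr_sumr -big_split/=; apply: eq_bigr => k _.
  by rewrite box_dist_linear// mulrDr mulrCA.
exists (\sum_(k < size Q) cabs Q`_k * 4), 0%N => Phi sPhi.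
rewrite mulr_suml; apply: le_trans (cabs_sum _ _ _) _.
by apply: ler_sum => k _; rewrite cabsM -mulrA ler_wpM2l ?cabs_ge0// cabs_box_dist.
Qed.

(** The multiplier is a sum of modulated cardinal sines, and modulation by [k * delta] translates
    the box in [nu] by the same amount; linearity reduces the claim to [box_dist_tf_product]. *)
Lemma spreading_function_opH : spreading_function (opH mult d) spread.
Proof.
split; first exact: tempered_spread.
move=> f h sf sh; rewrite /spread.
have [K HK] := schwartz1_bounded sf.
have mf := schwartz1_cmfun sf.
have avgK x : cabs (avg d f x) <= 2 * K.
  rewrite avgE//; apply: cabs_cintegral_cboxM => //.
  by apply: (cmfun_comp mf); exact: measurable_funB.
have ik (w : R) : cintegrable (fun x => expi2pi (x * w) * sinc g x * avg d f x * conjc (h x)).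
  apply: (@cintegrableM_bounded _ _ _ (2 * (2 * K))).
  - exact/cintegrableJ/schwartz1_cintegrable.
  - apply: cmfunM; last exact: cmfun_avg.
    apply: cmfunM; last exact: cmfun_sinc.
    by apply: (cmfun_comp (@cmfun_expi2pi R)); exact: measurable_funM.
  - by move=> x; rewrite !cabsM cabs_expi2pi mul1r ler_pM ?cabs_ge0// cabs_sinc.
transitivity (cintegral (fun x => \sum_(k < size Q)
    Q`_k * (expi2pi (x * (k%:R * delta)) * sinc g x * avg d f x * conjc (h x)))).
  apply: eq_cintegral => x; rewrite /opH /mult trig_polyE !mulr_suml.
  by apply: eq_bigr => k _; rewrite !mulrA.
rewrite cintegral_sum; last by move=> k; exact: cintegrableZ.
by apply: eq_bigr => k _; rewrite cintegralZ// box_dist_tf_product.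
Qed.

(** Around a point off the rectangle, the complement of the rectangle is an admissible open set. A
    test function supported there vanishes on every box carrying a term of [spread], so its pairing
    is 0. *)
Lemma dsupp_spread (alpha beta : R) : d <= alpha ->
  (forall k, (k < size Q)%N -> `|k%:R * delta| + g <= beta) ->
  dsupp spread `<=` `[- alpha, alpha] `*` `[- beta, beta].
Proof.
move=> da gb p pS; apply: contrapT => pN.
have Sclosed : closed (`[- alpha, alpha] `*` `[- beta, beta] : set (R * R)).
  apply: compact_closed; first exact: norm_hausdorff.
  by apply: compact_setX; exact: segment_compact.
have [Phi [_ _ supp]] := pS _ (closed_openC Sclosed) pN.
apply/negP; rewrite negbK /spread; apply/eqP; apply: big1 => k _.
rewrite box_dist_eq0 ?mulr0// => t nu td ng; apply: contrapT => /eqP Phi0.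
have /supp : fsupp Phi (t, nu + k%:R * delta) by apply: subset_closure.
apply; split; rewrite /= in_itv/=.
  by case/andP: td => ? ?; apply/andP; split; lra.
have := gb k (ltn_ord k); have := ler_norm (k%:R * delta).
have := ler_norm (- (k%:R * delta)); rewrite normrN.
by case/andP: ng => ? ? ? ? ?; apply/andP; split; lra.
Qed.

Lemma OPW_opH (alpha beta : R) : d <= alpha ->
  (forall k, (k < size Q)%N -> `|k%:R * delta| + g <= beta) ->
  OPW (`[- alpha, alpha] `*` `[- beta, beta]) (opH mult d).
Proof.
move=> da gb; split; first exact: bounded_linear_opH L2_mult d0.
by exists spread; split; [exact: spreading_function_opH|exact: dsupp_spread].
Qed.

End SpreadingFunction.

(** * Tails and supports *)

Section Tails.
Context {R : realType}.
Local Notation mu := (@lebesgue_measure R).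
Implicit Types y : R -> R[i].

Lemma sq_split y (D : set R) : measurable D -> cmfun y ->
  (sq y = \int[mu]_(x in D) (cabs (y x) ^+ 2)%:E +
          \int[mu]_(x in ~` D) (cabs (y x) ^+ 2)%:E)%E.
Proof.
move=> mD my; rewrite /sq -(setUv D) ge0_integral_setU//.
- exact: measurableC.
- by rewrite setUv; exact: measurable_cabs2.
- by move=> x _; rewrite lee_fin sqr_ge0.
- exact/disj_setPCl.
Qed.

Lemma L2_tail y (e : R) : L2 y -> 0 < e -> exists2 B : R, 0 < B &
  (\int[mu]_(x in ~` `[(- B)%R, B]) (cabs (y x) ^+ 2)%:E < e%:E)%E.
Proof.
move=> Ly e0; have my := L2_cmfun Ly.
have mD (n : nat) : measurable (~` `[(- n%:R)%R, n%:R]%classic : set R).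
  by apply: measurableC; exact: measurable_itv.
have [] := @dominated_convergence _ _ _ mu setT measurableT
  (fun n x => (cabs (y x) ^+ 2 * \1_(~` `[(- n%:R)%R, n%:R]) x)%:E) (cst 0%E)
  (fun x => (cabs (y x) ^+ 2)%:E).
- move=> n; apply/measurable_EFinP/measurable_funM.
    by apply/measurable_funX; exact: measurable_cabs.
  by apply: measurable_indic; exact: mD.
- exact: measurable_cst.
- apply: aeW => x _; apply: cvg_near_cst.
  exists (Num.truncn `|x|).+1 => // n /= xn.
  have {}xn : `|x| <= n%:R.
    by apply/ltW; apply: lt_le_trans (truncnS_gt _) _; rewrite ler_nat.
  rewrite indicE memNset ?mulr0//= in_itv/= => /negP.
  by rewrite -ler_norml xn.
- exact: L2_integrable.
- apply: aeW => x n _; rewrite gee0_abs lee_fin ?mulr_ge0 ?cabs_ge0 ?sqr_ge0//.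
  by rewrite ler_piMr ?sqr_ge0 ?indic_le1.
move=> _ _; rewrite integral0 => H.
have : nbhs (0 : \bar R) [set z | (z < e%:E)%E].
  by apply: open_nbhs_nbhs; split; [exact: open_ereal_lt_ereal|rewrite /= lte_fin].
(* The successor ensures [0 < B] even when the threshold [N] is 0. *)
move=> /H [N _ HN]; exists N.+1%:R; first by rewrite ltr0n.
have := HN N.+1 (leqnSn N); rewrite /=; apply: le_lt_trans.
rewrite integral_mkcond; apply: ge0_le_integral => //.
- by move=> x _; rewrite patchE; case: ifP => // _; rewrite lee_fin sqr_ge0.
- apply/(measurable_restrictT _ (mD N.+1)).
  by apply: measurable_funTS; exact: measurable_cabs2.
- apply/measurable_EFinP/measurable_funM.
    by apply/measurable_funX; exact: measurable_cabs.
  by apply: measurable_indic; exact: mD.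
- by move=> x _; rewrite patchE indicE; case: ifP => _; rewrite ?mulr1 ?mulr0.
Qed.

Lemma ae_sub (P P' : R -> Prop) : (forall u, P u -> P' u) ->
  (\forall u \ae mu, P u) -> \forall u \ae mu, P' u.
Proof. by move=> PP'; exact: (@filterS _ _ (ae_filter_ringOfSetsType mu) _ _ PP'). Qed.

Lemma ae_and (P P' : R -> Prop) : (\forall u \ae mu, P u) -> (\forall u \ae mu, P' u) ->
  \forall u \ae mu, P u /\ P' u.
Proof. exact: (@filterI _ _ (ae_filter_ringOfSetsType mu)). Qed.

Lemma ae_forall_nat (P : nat -> R -> Prop) : (forall n, \forall u \ae mu, P n u) ->
  \forall u \ae mu, forall n, P n u.
Proof.
move=> aeP; have := negligible_bigcup aeP; apply: negligibleS => u /= /existsNP[n nP].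
by exists n.
Qed.

(** Each point off the support has its own open set where [y] vanishes almost everywhere. Replacing
    these sets by rational intervals leaves countably many exceptional null sets. *)
Lemma ae_zero_off_L2supp y : {ae mu, forall u, ~ L2supp y u -> y u = 0}.
Proof.
pose I (n : nat) : set R :=
  if unpickle n is Some (p, q) then `](ratr (p : rat)), (ratr (q : rat))[%classic else set0.
pose P n := {ae mu, forall u, I n u -> y u = 0}.
(* With [P n] as a premise, the property holds almost everywhere for every index, including
   intervals on which [y] does not vanish, so the countable intersection applies. *)
have H n : {ae mu, forall u, P n -> I n u -> y u = 0}.
  have [Pn|Pn] := pselect (P n); last by apply: aeW => u /Pn.
  by apply: ae_sub Pn => u h _.
apply: ae_sub (ae_forall_nat H) => u Hu uN.
move: uN => /existsNP[U /not_implyP[oU /not_implyP[Uu /contrapT yU]]].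
have /nbhs_ballP[r /= r0 rU] : nbhs u U by exact: open_nbhs_nbhs.
have [p] := @rat_in_itvoo R (u - r) u (ltac:(by rewrite ltrBlDr ltrDl)).
rewrite in_itv/= => /andP[p1 p2].
have [q] := @rat_in_itvoo R u (u + r) (ltac:(by rewrite ltrDl)).
rewrite in_itv/= => /andP[q1 q2].
have IE : I (pickle (p, q)) = `](ratr p), (ratr q)[%classic by rewrite /I pickleK.
apply: (Hu (pickle (p, q))).
  rewrite /P IE; apply: ae_sub yU => v h; rewrite /= in_itv/= => /andP[v1 v2].
  apply: h; apply: rU; rewrite /ball/= ltr_distl; apply/andP; split; lra.
by rewrite IE /= in_itv/= p2 q1.
Qed.

Lemma L2supp_tail y (M : R) : cmfun y -> L2supp y `<=` `[(- M)%R, M] ->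
  (\int[mu]_(x in ~` `[(- M)%R, M]) (cabs (y x) ^+ 2)%:E = 0)%E.
Proof.
move=> my yM; rewrite -[RHS](@integral0 _ _ _ mu (~` `[(- M)%R, M])).
apply: ge0_ae_eq_integral => //.
- by apply: measurableC; exact: measurable_itv.
- by apply: measurable_funTS; exact: measurable_cabs2.
- by move=> x _; rewrite lee_fin sqr_ge0.
- apply: ae_sub (ae_zero_off_L2supp y) => u h uM.
  by rewrite h ?cabs0 ?expr0n// => /yM.
Qed.

(** For [M <= 0] the interval is contained in the null set [{0}], so [y] would vanish almost
    everywhere. *)
Lemma L2supp_radius_gt0 y (M : R) : ~ ae_equal y (fun=> 0) ->
  L2supp y `<=` `[(- M)%R, M] -> 0 < M.
Proof.
move=> y0 yM; rewrite ltNge; apply/negP => M0; apply: y0.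
have n0 : {ae mu, forall u : R, u != 0}.
  exists [set 0]; split => //; first exact: lebesgue_measure_set1.
  by move=> u /= /negP; rewrite negbK => /eqP.
apply: ae_sub (ae_and n0 (ae_zero_off_L2supp y)) => u [u0 h]; apply: h => /yM.
rewrite /= in_itv/= => /andP[u1 u2]; move/eqP: u0; apply; lra.
Qed.

End Tails.

(** Three squared errors of size [eps^2 / 8] arise, from the edges, from inside [[-B, B]] and from
    the tail. With the factor 2 of [sqD] they add up to [3 / 4 * eps^2]. *)
Lemma approximating_operator (R : realType) (alpha beta eps B : R) (y : R -> R[i]) :
  0 < alpha -> 0 < beta -> 0 < eps -> 0 < B -> L2 y ->
  (\int[@lebesgue_measure R]_(x in ~` `[(- B)%R, B]) (cabs (y x) ^+ 2)%:E <
    (eps ^+ 2 / 8)%:E)%E ->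
  exists H : (R -> R[i]) -> (R -> R[i]),
    [/\ hilbert_schmidt H,
        OPW (`[- alpha, alpha] `*` `[- beta, beta]) H &
        (L2norm (fun x => H (chi `[(- B)%R, B]) x - y x)%R < eps%:E)%E].
Proof.
move=> a0 b0 e0 B0 Ly tail; have my := L2_cmfun Ly.
have e80 : 0 < eps ^+ 2 / 8 by rewrite divr_gt0// exprn_gt0.
have mD : measurable (`[(- B)%R, B]%classic : set R) by exact: measurable_itv.
have [|g [delta [Q [g0 gb near]]]] := trig_dense B0 b0 e80 my.
  have [_] := (L2P y).1 Ly; rewrite (sq_split mD my); apply: le_lt_trans.
  by rewrite leeDl// integral_ge0// => x _; rewrite lee_fin sqr_ge0.
have [M M0 HM] := mult_bounded delta Q g0.
(* The bound [M] of the multiplier is already fixed here. The second entry brings the edge error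
   [36 M^2 d] down to [eps^2 / 8], and the added 1 keeps the denominator positive. *)
pose d := Num.min alpha (eps ^+ 2 / 8 / (36 * M ^+ 2 + 1)).
have M1 : 0 < 36 * M ^+ 2 + 1 by rewrite ltr_wpDl// mulr_ge0// sqr_ge0.
have d0 : 0 < d by rewrite lt_min a0 divr_gt0.
have dM : 36 * M ^+ 2 * d <= eps ^+ 2 / 8.
  apply: (@le_trans _ _ ((36 * M ^+ 2 + 1) * d)).
    by rewrite ler_wpM2r ?(ltW d0)// lerDl.
  by rewrite mulrC -ler_pdivlMr// ge_min lexx orbT.
have da : d <= alpha by rewrite ge_min lexx.
have Lm := L2_mult delta Q g0; have mm := L2_cmfun Lm.
exists (opH (mult g delta Q) d); split.
- exact: hilbert_schmidt_opH.
- exact: OPW_opH.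
apply: L2norm_lt => //.
set D := `[(- B)%R, B]%classic.
have mchi : cmfun (chi D) := cmfun_chi mD.
have mmchi : cmfun (fun x => mult g delta Q x * chi D x) := cmfunM mm mchi.
have mH : cmfun (opH (mult g delta Q) d (chi D)).
  by apply: cmfun_opH => //; exact: L2_chi.
rewrite (_ : (fun x => _) = (fun x =>
    (opH (mult g delta Q) d (chi D) x - mult g delta Q x * chi D x) +
    (mult g delta Q x * chi D x - y x))); last by apply/funext => x; rewrite addrA subrK.
apply: le_lt_trans (sqD (cmfunB mH mmchi) (cmfunB mmchi my)) _.
have s1 : (sq (fun x => opH (mult g delta Q) d (chi D) x - mult g delta Q x * chi D x)%R <=
    (eps ^+ 2 / 8)%:E)%E.
  by apply: le_trans (opH_chi_sub Lm d0 B HM) _; rewrite lee_fin.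
have s2 : (sq (fun x => mult g delta Q x * chi D x - y x)%R <
    (eps ^+ 2 / 8)%:E + (eps ^+ 2 / 8)%:E)%E.
  rewrite (sq_split mD (cmfunB mmchi my)); apply: lteD.
    apply: le_lt_trans near; rewrite le_eqVlt; apply/orP; left; apply/eqP.
    by apply: eq_integral => x /[!inE] xD; rewrite chi_in// mulr1.
  apply: le_lt_trans tail; rewrite le_eqVlt; apply/orP; left; apply/eqP.
  by apply: eq_integral => x /[!inE] xD; rewrite chi_out// mulr0 sub0r cabsN.
apply: (@lt_trans _ _ (2%:E * ((eps ^+ 2 / 8)%:E + ((eps ^+ 2 / 8)%:E + (eps ^+ 2 / 8)%:E)))%E).
  rewrite lte_pmul2l// lee_ltD// ge0_fin_numE ?sq_ge0//.
  exact: le_lt_trans s1 (ltry _).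
rewrite -!EFinD -EFinM lte_fin; have : 0 < eps ^+ 2 by rewrite exprn_gt0.
by move: (eps ^+ 2) => E E0; lra.
Qed.

Theorem theorem1 (R : realType) (alpha beta : R) (halpha : 0 < alpha)
    (hbeta : 0 < beta) (eps : R) (heps : 0 < eps) :
  let attained (y : R -> R[i]) (B : R) :=
    exists H : (R -> R[i]) -> (R -> R[i]),
      [/\ hilbert_schmidt H,
          OPW (`[- alpha, alpha] `*` `[- beta, beta]) H &
          (L2norm (fun x => H (chi `[(- B)%R, B]) x - y x)%R < eps%:E)%E] in
  exists c : R, [/\ 0 < c, c < 1 &
    forall y : R -> R[i], L2 y -> ~ ae_equal y (fun=> 0) ->
      [/\ exists B : R, 0 < B /\ attained y B,
          forall B : R, 0 < B ->
            (\int[@lebesgue_measure R]_(x in ~` `[(- B)%R, B])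
               (cabs (y x) ^+ 2)%:E < (c * eps)%:E)%E ->
            attained y B &
          forall M : R, L2supp y `<=` `[(- M)%R, M] ->
            0 < M /\ attained y M]].
Proof.
(* The entry [eps / 8] turns the tail bound [c * eps] into [eps^2 / 8]; the entry [1 / 2] secures
   [c < 1]. *)
move=> attained; pose c := Num.min (1 / 2) (eps / 8).
have c0 : 0 < c by rewrite lt_min !divr_gt0.
have ce : c * eps <= eps ^+ 2 / 8.
  by rewrite expr2 mulrAC ler_wpM2r ?(ltW heps)// ge_min lexx orbT.
exists c; split => //; first by rewrite gt_min; apply/orP; left; lra.
move=> y Ly y0.
have main B : 0 < B -> (\int[@lebesgue_measure R]_(x in ~` `[(- B)%R, B])
    (cabs (y x) ^+ 2)%:E < (c * eps)%:E)%E -> attained y B.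
  move=> B0 tail; apply: approximating_operator => //.
  by apply: lt_le_trans tail _; rewrite lee_fin.
have ce0 : 0 < c * eps by rewrite mulr_gt0.
split => //.
- by have [B B0 tail] := L2_tail Ly ce0; exists B; split => //; exact: main.
- move=> M yM; have M0 := L2supp_radius_gt0 y0 yM; split => //.
  by apply: main => //; rewrite (L2supp_tail (L2_cmfun Ly) yM) lte_fin.
Qed.
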